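(* Let $0<a<b$, and let $f_0:[a,b]\to\mathbb{R}^{p_0}$, $\tilde f_1:[a,b]\to\mathbb{R}^{p_1-p_0}$, $\tilde f_2:[a,b]\to\mathbb{R}^{p_2-p_0}$ be continuously differentiable such that, for $i=1,2$, the components of $f_i=(f_0^\top,\tilde f_i^\top)^\top$ are linearly independent. Consider the continuous time regression model $$\begin{pmatrix}Y_1(t)\\ Y_2(t)\end{pmatrix}=\begin{pmatrix}f_0^\top(t)&\tilde f_1^\top(t)&0_{p_2-p_0}^\top\\ f_0^\top(t)&0_{p_1-p_0}^\top&\tilde f_2^\top(t)\end{pmatrix}\begin{pmatrix}\theta^{(0)}\\\tilde\theta^{(1)}\\\tilde\theta^{(2)}\end{pmatrix}+\mathbf{\Sigma}^{1/2}\boldsymbol{\varepsilon}(t),\qquad t\in[a,b],$$ with $\theta^{(0)}\in\mathbb{R}^{p_0}$, $\tilde\theta^{(i)}\in\mathbb{R}^{p_i-p_0}$, $\boldsymbol{\varepsilon}=(\varepsilon_1,\varepsilon_2)^\top$ a vector of two independent Brownian motions on $[a,b]$, and $\mathbf{\Sigma}=\begin{pmatrix}\sigma_1^2&\sigma_1\sigma_2\varrho\\ \sigma_1\sigma_2\varrho&\sigma_2^2\end{pmatrix}$, $\sigma_1,\sigma_2>0$. Put $\theta^{(\ell)}=((\theta^{(0)})^\top,(\tilde\theta^{(\ell)})^\top)^\top$. Let $\hat\theta^{(\ell)}_{\rm BLUE}$ be the best linear unbiased estimator of $\theta^{(\ell)}$ obtained by simultaneous estimation from both groups, and $\hat\theta^{(\ell)}_{\rm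 mar}$ the best linear unbiased estimator of $\theta^{(\ell)}$ obtained by separate estimation from the $\ell$-th group only. Then, with respect to the Loewner ordering, $$\mathrm{Cov}(\hat\theta^{(\ell)}_{\rm BLUE})\le\mathrm{Cov}(\hat\theta^{(\ell)}_{\rm mar}),\qquad\ell=1,2,$$ for all $\varrho\in(-1,1)$.
   Context: The Brownian motions on $[a,b]$ are centered continuous Gaussian processes with covariance $\min(s,t)$. $\mathbf{\Sigma}^{1/2}$ is the symmetric square root of $\mathbf{\Sigma}$; a dot denotes differentiation in $t$. Loewner ordering: $A\le B$ iff $B-A$ is nonnegative definite. Simultaneous estimation: let $p=p_1+p_2-p_0$, let $\mathbf{F}^\top(t)$ be the $(2\times p)$ regression matrix in the model, $\mathbf{Y}=(Y_1,Y_2)^\top$, and $\mathbf{M}=\int_a^b\dot{\mathbf{F}}(t)\mathbf{\Sigma}^{-1}\dot{\mathbf{F}}^\top(t)dt+\frac1a\mathbf{F}(a)\mathbf{\Sigma}^{-1}\mathbf{F}^\top(a)$ (assumed non-singular). The BLUE of $\theta=((\theta^{(0)})^\top,(\tilde\theta^{(1)})^\top,(\tilde\theta^{(2)})^\top)^\top$ is $$\begin{pmatrix}\hat\theta^{(0)}_{\rm BLUE}\\\hat{\tilde\theta}^{(1)}_{\rm BLUE}\\\hat{\tilde\theta}^{(2)}_{\rm BLUE}\end{pmatrix}=\mathbf{M}^{-1}\Big(\int_a^b\dot{\mathbf{F}}(t)\mathbf{\Sigma}^{-1}d\mathbf{Y}(t)+\frac1a\mathbf{F}(a)\mathbf{\Sigma}^{-1}\mathbf{Y}(a)\Big)$$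 with covariance matrix $\mathbf{M}^{-1}$, and $\hat\theta^{(\ell)}_{\rm BLUE}=((\hat\theta^{(0)}_{\rm BLUE})^\top,(\hat{\tilde\theta}^{(\ell)}_{\rm BLUE})^\top)^\top$. Separate estimation: for $\ell=1,2$, with $f_\ell=(f_0^\top,\tilde f_\ell^\top)^\top$ and $\mathbf{N}_\ell=\int_a^b\dot f_\ell(t)\dot f_\ell^\top(t)dt+\frac1a f_\ell(a)f_\ell^\top(a)$, $$\hat\theta^{(\ell)}_{\rm mar}=\mathbf{N}_\ell^{-1}\Big(\int_a^b\dot f_\ell(t)\,dY_\ell(t)+\frac1a f_\ell(a)Y_\ell(a)\Big),$$ with covariance matrix $\sigma_\ell^2\mathbf{N}_\ell^{-1}$. *)

(* Defs.v *)
From HB Require Import structures.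
From mathcomp Require Import all_boot all_order all_algebra.
From mathcomp Require Import all_classical all_reals all_analysis.
Import Order.TTheory GRing.Theory Num.Theory.
Import numFieldNormedType.Exports.

Set Implicit Arguments.
Unset Strict Implicit.
Unset Printing Implicit Defensive.

Local Open Scope classical_set_scope.
Local Open Scope ring_scope.

Section matrices.
Context {R : realType}.

Definition nnegdefmx n (A : 'M[R]_n) : Prop :=
  A^T = A /\ forall x : 'cV[R]_n, 0 <= (x^T *m A *m x) ord0 ord0.

Definition loewner_le n (A B : 'M[R]_n) : Prop := nnegdefmx (B - A).

(* Such an S exists and is unique when A is nonnegative definite. *)
Definition is_sqrtmx n (A S : 'M[R]_n) : Prop := nnegdefmx S /\ S *m S = A.

Definition Sigma_mx (sigma1 sigma2 rho : R) : 'M[R]_2 :=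
  col_mx (row_mx (sigma1 ^+ 2)%:M (sigma1 * sigma2 * rho)%:M)
         (row_mx (sigma1 * sigma2 * rho)%:M (sigma2 ^+ 2)%:M)
    : 'M[R]_(1 + 1, 1 + 1).

End matrices.

Section calculus.
Context {R : realType}.
Variables a b : R.

Definition diff_quot (f : R -> R) (t s : R) : R := (f s - f t) / (s - t).

(* Derivative of a function on [a, b]: s tends to t inside [a, b] with s != t,
   so the derivatives at a and b are one-sided and the values of f outside of
   [a, b] are irrelevant. *)
Definition dot (f : R -> R) (t : R) : R :=
  lim (diff_quot f t s @[s --> within `[a, b] t^']).

Definition C1 (f : R -> R) : Prop :=
  (forall t, t \in `[a, b] -> cvg (diff_quot f t s @[s --> within `[a, b] t^']))
  /\ {within `[a, b], continuous (dot f)}.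

Definition C1mx m n (F : R -> 'M[R]_(m, n)) : Prop :=
  forall i j, C1 (fun t => F t i j).

Definition dmx m n (F : R -> 'M[R]_(m, n)) (t : R) : 'M[R]_(m, n) :=
  \matrix_(i, j) dot (fun s => F s i j) t.

Definition intmx m n (F : R -> 'M[R]_(m, n)) : 'M[R]_(m, n) :=
  \matrix_(i, j) (\int[lebesgue_measure]_(t in `[a, b]) F t i j)%R.

Definition lin_indep n (f : R -> 'cV[R]_n) : Prop :=
  forall c : 'rV[R]_n,
    (forall t, t \in `[a, b] -> c *m f t = 0) -> c = 0.

End calculus.

Section probability.
Context {R : realType} {d : measure_display} {Omega : measurableType d}.
Variable P : probability Omega R.

(* Point masses are allowed; [normal_prob m 0] is not the point mass at m. *)
Definition gaussian_var (X : Omega -> R) : Prop :=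
  exists m s : R, 0 <= s /\
    forall A : set R, measurable A ->
      P (X @^-1` A) = if s == 0 then \d_m A else normal_prob m s A.

Definition gaussian_process (D : set R) (X : R -> {RV P >-> R}) : Prop :=
  forall n (t c : 'I_n -> R), (forall i, D (t i)) ->
    gaussian_var (fun w => \sum_(i < n) c i * X (t i) w).

Definition brownian (a b : R) (X : R -> {RV P >-> R}) : Prop :=
  [/\ gaussian_process `[a, b] X,
      (forall t, t \in `[a, b] -> ('E_P[X t] = 0)%E),
      (forall s t, s \in `[a, b] -> t \in `[a, b] ->
         covariance P (X s) (X t) = (Num.min s t)%:E) &
      {ae P, forall w, {within `[a, b], continuous (fun t => X t w)}}].

Definition process_sigma (D : set R) (X : R -> {RV P >-> R})
    : set (set Omega) :=
  <<s [set A | exists t, exists B : set R,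
         [/\ D t, measurable B & A = X t @^-1` B]] >>.

Definition indep_processes (D : set R) (X Y : R -> {RV P >-> R}) : Prop :=
  forall A B, process_sigma D X A -> process_sigma D Y B ->
    P (A `&` B) = (P A * P B)%E.

Definition Cov n (X : Omega -> 'cV[R]_n) : 'M[R]_n :=
  \matrix_(i, j)
    fine (covariance P (fun w => X w i ord0) (fun w => X w j ord0)).

(* [s] lists the points of the partition after the first one, [a]. *)
Definition mesh_lt (a : R) (s : seq R) (delta : R) : Prop :=
  forall k, (k < size s)%N -> nth 0 s k - nth 0 (a :: s) k < delta.

Definition ito_sum m n (a : R) (s : seq R) (G : R -> 'M[R]_(m, n))
    (Y : R -> Omega -> 'cV[R]_n) (w : Omega) : 'cV[R]_m :=
  \sum_(k < size s) G (nth 0 (a :: s) k) *m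
     (Y (nth 0 s k) w - Y (nth 0 (a :: s) k) w).

(* I is (a version of) the stochastic integral of the deterministic function G
   with respect to Y over [a, b]: the L^2(P) limit of the sums above as the
   mesh of the partition tends to 0. *)
Definition is_stoch_int m n (a b : R) (G : R -> 'M[R]_(m, n))
    (Y : R -> Omega -> 'cV[R]_n) (I : Omega -> 'cV[R]_m) : Prop :=
  forall i : 'I_m,
    measurable_fun [set: Omega] (fun w => I w i ord0) /\
    forall e : R, 0 < e -> exists2 delta : R, 0 < delta &
      forall s : seq R, itv_partition a b s -> mesh_lt a s delta ->
        ('E_P[(fun w => (ito_sum a s G Y w i ord0 - I w i ord0) ^+ 2)%R]
           < e%:E)%E.

End probability.

Section model.
Context {R : realType} {p0 q1 q2 : nat}.
Variables (f0 : R -> 'cV[R]_p0) (g1 : R -> 'cV[R]_q1) (g2 : R -> 'cV[R]_q2).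

(* f0 gathers the regression functions shared by the two groups; g1 and g2 are
   those specific to group 1 and to group 2. *)
Definition stack n (g : R -> 'cV[R]_n) (t : R) : 'cV[R]_(p0 + n) :=
  col_mx (f0 t) (g t).

Definition FT (t : R) : 'M[R]_(2, p0 + (q1 + q2)) :=
  col_mx (row_mx (f0 t)^T (row_mx (g1 t)^T 0))
         (row_mx (f0 t)^T (row_mx 0 (g2 t)^T))
    : 'M[R]_(1 + 1, p0 + (q1 + q2)).

Definition Fmx (t : R) : 'M[R]_(p0 + (q1 + q2), 2) := (FT t)^T.

Definition response (Omega : Type) (S : 'M[R]_2) (eps1 eps2 : R -> Omega -> R)
    (theta : 'cV[R]_(p0 + (q1 + q2))) (t : R) (w : Omega) : 'cV[R]_2 :=
  FT t *m theta +
  S *m (col_mx (eps1 t w)%:M (eps2 t w)%:M : 'cV[R]_(1 + 1)).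

End model.

Section estimators.
Context {R : realType} {Omega : Type}.
Variables a b : R.

Definition Mmx p (F : R -> 'M[R]_(p, 2)) (Sigma : 'M[R]_2) : 'M[R]_p :=
  intmx a b (fun t => dmx a b F t *m invmx Sigma *m (dmx a b F t)^T)
  + a^-1 *: (F a *m invmx Sigma *m (F a)^T).

(* In the two estimators below, I is meant to be the stochastic integral over
   [a, b] (see [is_stoch_int]) of dmx F *m invmx Sigma, respectively dmx f,
   with respect to Y. *)
Definition theta_BLUE p (F : R -> 'M[R]_(p, 2)) (Sigma : 'M[R]_2)
    (Y : R -> Omega -> 'cV[R]_2) (I : Omega -> 'cV[R]_p) (w : Omega) : 'cV_p :=
  invmx (Mmx F Sigma) *m (I w + a^-1 *: (F a *m invmx Sigma *m Y a w)).

Definition Nmx p (f : R -> 'cV[R]_p) : 'M[R]_p :=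
  intmx a b (fun t => dmx a b f t *m (dmx a b f t)^T)
  + a^-1 *: (f a *m (f a)^T).

Definition theta_mar p (f : R -> 'cV[R]_p)
    (Y : R -> Omega -> 'cV[R]_1) (I : Omega -> 'cV[R]_p) (w : Omega) : 'cV_p :=
  invmx (Nmx f) *m (I w + a^-1 *: (f a *m Y a w)).

Definition subest1 p0 q1 q2 (T : Omega -> 'cV[R]_(p0 + (q1 + q2))) (w : Omega)
    : 'cV[R]_(p0 + q1) :=
  col_mx (usubmx (T w)) (usubmx (dsubmx (T w))).

Definition subest2 p0 q1 q2 (T : Omega -> 'cV[R]_(p0 + (q1 + q2))) (w : Omega)
    : 'cV[R]_(p0 + q2) :=
  col_mx (usubmx (T w)) (dsubmx (dsubmx (T w))).

Definition component (l : 'I_2) (Y : R -> Omega -> 'cV[R]_2) (t : R) (w : Omega)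
    : 'cV[R]_1 := row l (Y t w).

End estimators.

(* Main.v *)
Require Import Defs.
From HB Require Import structures.
From mathcomp Require Import all_boot all_order all_algebra.
From mathcomp Require Import all_classical all_reals all_analysis.
From mathcomp Require Import measurable_realfun ring lra.
Import Order.TTheory GRing.Theory Num.Theory.
Import numFieldNormedType.Exports.
Set Implicit Arguments.
Unset Strict Implicit.
Local Open Scope classical_set_scope.
Local Open Scope ring_scope.

(** The proof is the Gauss-Markov argument: the difference between the
    marginal estimator and the corresponding part of the BLUE is uncorrelated
    with the latter, so that Cov(mar) = Cov(BLUE) + Cov(mar - BLUE), and the
    last term is nonnegative definite ([loewner_orthogonal]).

    The two estimators are linear images of random vectors of the form
    int G dY + A Y(a). For a process Y whose covariance is min(s, t) K, the
    Ito isometry gives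
      cov(int G dY + A Y(a), int H dY + B Y(a))
        = int G K H^T dt + a A K B^T
    ([xcov_estimating]). The weights of the BLUE contain the inverse of Sigma,
    which cancels K = Sigma. Hence the vector T behind the BLUE satisfies
    cov(T, T) = M. Let U be the vector behind the marginal estimator of the
    group l, and let C be the 0-1 matrix such that theta^(l) = C theta. The
    column l of F is C^T f_l, and therefore cov(T, U) = C^T N_l. It follows
    that
      cov(C M^-1 T, N_l^-1 U) = C M^-1 C^T = cov(C M^-1 T, C M^-1 T),
    which is the required orthogonality ([BLUE_le_mar]).

    For the isometry, the covariance of two Ito sums over the same partition
    is exactly a Riemann sum, since increments are orthogonal
    ([xcov_ito_ito]). As the mesh tends to 0, the left-hand side converges by
    continuity of the covariance in L^2 ([rcov_approx]) and the right-hand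
    side by uniform continuity of the integrand ([riemann_sum_close]).

    The matrix N_l is invertible because c N_l c^T = 0 forces the function
    c f_l to have a zero derivative and to vanish at a, so that c = 0 by linear
    independence ([Nmx_unit]). The independence of the two Brownian motions
    enters through E[XY] = E[X] E[Y] ([indep_expectationM]), which makes
    min(s, t) times the identity the covariance of the noise, and
    min(s, t) Sigma that of Y. *)

(** * Covariance of square-integrable random variables *)

Section cov.
Context {R : realType} {d : measure_display} {Omega : measurableType d}.
Variable P : probability Omega R.
Implicit Types X Y Z : Omega -> R.

(** Between square-integrable variables the covariance is finite
    ([covariance_rcov]), and real values allow ring reasoning. *)
Definition rcov X Y : R := fine (covariance P X Y).

Lemma Lfun2_Lfun1 X : X \in Lfun P 2%:E -> X \in Lfun P 1.
Proof. by apply: Lfun_subset12; exact: fin_num_measure. Qed.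
Local Hint Resolve Lfun2_Lfun1 : core.

Lemma covariance_rcov X Y : X \in Lfun P 2%:E -> Y \in Lfun P 2%:E ->
  covariance P X Y = (rcov X Y)%:E.
Proof.
move=> X2 Y2; rewrite /rcov fineK//.
by rewrite covariance_fin_num ?Lfun2_mul_Lfun1//; exact: Lfun2_Lfun1.
Qed.

Lemma rcovC X Y : rcov X Y = rcov Y X.
Proof. by rewrite /rcov covarianceC. Qed.

Lemma rcovDl X Y Z : X \in Lfun P 2%:E -> Y \in Lfun P 2%:E ->
  Z \in Lfun P 2%:E -> rcov (X \+ Y) Z = rcov X Z + rcov Y Z.
Proof.
by move=> X2 Y2 Z2; rewrite /rcov covarianceDl// !covariance_rcov//.
Qed.

Lemma Lfun2_scale (a : R) X : X \in Lfun P 2%:E ->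
  (fun w => a * X w) \in Lfun P 2%:E.
Proof.
move=> X2; rewrite (_ : (fun w => _) = a \o* X); last first.
  by apply/funext => w /=; rewrite mulrC.
by rewrite Lfun_scale// ler1n.
Qed.

Lemma Lfun2D X Y : X \in Lfun P 2%:E -> Y \in Lfun P 2%:E ->
  X \+ Y \in Lfun P 2%:E.
Proof. by move=> X2 Y2; rewrite rpredD// lee1n. Qed.

Lemma rcovZl (a : R) X Y : X \in Lfun P 2%:E -> Y \in Lfun P 2%:E ->
  rcov (fun w => a * X w) Y = a * rcov X Y.
Proof.
move=> X2 Y2; rewrite (_ : (fun w => _) = a \o* X); last first.
  by apply/funext => w /=; rewrite mulrC.
rewrite /rcov covarianceZl ?Lfun2_mul_Lfun1//; try exact: Lfun2_Lfun1.
by rewrite covariance_rcov.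
Qed.

Lemma rcov_ge0 X : 0 <= rcov X X.
Proof. by rewrite /rcov fine_ge0// (variance_ge0 P X). Qed.

Lemma rcov_cstl c X : rcov (cst c) X = 0.
Proof. by rewrite /rcov covariance_cst_l. Qed.

Lemma sqr_expectation_Lfun2 X : measurable_fun setT X ->
  ('E_P[(fun w => (X w ^+ 2)%R)] < +oo)%E -> X \in Lfun P 2%:E.
Proof.
move=> mX EX; apply/andP; split; rewrite inE//=.
rewrite /finite_norm unlock /= poweR_lty//.
move: EX; rewrite unlock; apply: le_lt_trans.
apply: ge0_le_integral => //=.
- apply/measurable_EFinP.
  apply: (@measurableT_comp _ _ _ _ _ _ (fun x : R => x `^ 2)%R) => //.
  exact/measurableT_comp.
- by apply/measurable_EFinP; exact: measurable_funX.
- by move=> x _; rewrite lee_fin powR_mulrn// real_normK// num_real.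
Qed.

Lemma rcov_le_sqr X (e : R) : X \in Lfun P 2%:E ->
  ('E_P[(fun w => (X w ^+ 2)%R)] < e%:E)%E -> rcov X X <= e.
Proof.
move=> X2 Xe; rewrite -lee_fin -covariance_rcov//.
apply: le_trans (ltW Xe).
rewrite -/(variance P X) varianceE//.
rewrite leeBlDr ?leeDl ?sqre_ge0//.
by rewrite fin_numX// expectation_fin_num// Lfun2_Lfun1.
Qed.

(** A weighted form of the Cauchy-Schwarz inequality, which avoids square
    roots: expand the variance of e X + Y and that of e X - Y. *)
Lemma rcov_young X Y (e : R) : 0 < e -> X \in Lfun P 2%:E ->
  Y \in Lfun P 2%:E -> `|rcov X Y| <= e * rcov X X + e^-1 * rcov Y Y.
Proof.
move=> e0 X2 Y2.
have eX2 c : (fun w => c * X w) \in Lfun P 2%:E by exact: Lfun2_scale.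
have H c : 0 <= c ^+ 2 * rcov X X + rcov Y Y + 2 * c * rcov X Y.
  have := rcov_ge0 ((fun w => c * X w) \+ Y).
  rewrite rcovDl ?Lfun2D// rcovZl ?Lfun2D// !(rcovC _ (_ \+ _)).
  rewrite !rcovDl// !rcovZl// (rcovC Y X).
  by congr (0 <= _); ring.
have := H e; have := H (- e).
have := rcov_ge0 X; have := rcov_ge0 Y.
set x := rcov X X; set y := rcov Y Y; set z := rcov X Y => y0 x0 h1 h2.
have ye : y = e * (e^-1 * y) by rewrite mulrA divff ?mul1r ?gt_eqF.
have u0 : 0 <= e^-1 * y by rewrite mulr_ge0// invr_ge0 ltW.
rewrite ye in h1 h2; move: u0 h1 h2; move: (e^-1 * y) => u u0 h1 h2.
have {h1} : 0 <= e * (e * x + u - 2 * z).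
  apply: le_trans h1 _; rewrite le_eqVlt; apply/orP; left.
  by apply/eqP; ring.
have {h2} : 0 <= e * (e * x + u + 2 * z).
  apply: le_trans h2 _; rewrite le_eqVlt; apply/orP; left.
  by apply/eqP; ring.
rewrite !pmulr_rge0// => h1 h2.
have : 0 <= e * x by rewrite mulr_ge0// ltW.
rewrite ler_norml; move: (e * x) h1 h2 => v h1 h2 v0; apply/andP; split; lra.
Qed.

End cov.

(** * Expectation of a product of independent variables *)

Section indep.
Context {R : realType} {d : measure_display} {Omega : measurableType d}.
Variable P : probability Omega R.

(** Independence says that the joint law and the product of the marginal laws
    agree on rectangles, hence everywhere; Fubini's theorem then factors the
    integral of xy. *)
Lemma indep_expectationM (X Y : {RV P >-> R}) :
  (X : Omega -> R) \in Lfun P 2%:E -> (Y : Omega -> R) \in Lfun P 2%:E ->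
  (forall A B : set R, measurable A -> measurable B ->
    P ((X @^-1` A) `&` (Y @^-1` B)) = (P (X @^-1` A) * P (Y @^-1` B))%E) ->
  ('E_P[(X \* Y)%R] = 'E_P[X] * 'E_P[Y])%E.
Proof.
move=> X2 Y2 indep.
pose mu := distribution P X; pose nu := distribution P Y.
pose XY w := (X w, Y w).
have mXY : measurable_fun setT XY by apply/measurable_fun_pair.
have prodE A : measurable A -> (mu \x nu)%E A = pushforward P XY A.
  move=> mA.
  pose XY' : {mfun Omega >-> (R * R)%type} :=
    mfun_Sub (mem_set mXY : XY \in mfun).
  apply: (@product_measure_unique _ _ _ _ _ mu nu (pushforward P XY')) => //.
pose f (z : R * R) : \bar R := (z.1 * z.2)%:E.
have mf : measurable_fun setT f.
  by apply/measurable_EFinP; apply: measurable_funM.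
have fXY : P.-integrable setT (f \o XY).
  by apply/Lfun1_integrable; exact: Lfun2_mul_Lfun1.
pose XY' : {mfun Omega >-> (R * R)%type} :=
    mfun_Sub (mem_set mXY : XY \in mfun).
have fprod : (mu \x nu)%E.-integrable setT f.
  apply/integrableP; split => //.
  rewrite (eq_measure_integral (pushforward P XY')); last first.
    by move=> A mA _; exact: prodE.
  by have /integrableP[] :=
    integrable_pushforward (measurable_funP XY') mf fXY measurableT.
have I1 (Z : {RV P >-> R}) : (Z : Omega -> R) \in Lfun P 2%:E ->
    (distribution P Z).-integrable setT EFin.
  move=> Z2; apply: integrable_pushforward => //.
  exact/Lfun1_integrable/Lfun2_Lfun1.
have E1 (Z : {RV P >-> R}) : (Z : Omega -> R) \in Lfun P 2%:E ->
    (\int[distribution P Z]_y y%:E = 'E_P[Z])%E.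
  move=> Z2; rewrite unlock integral_distribution//.
  exact/Lfun1_integrable/Lfun2_Lfun1.
transitivity (\int[P]_w (f \o XY) w)%E; first by rewrite unlock.
rewrite -[LHS](integral_pushforward (measurable_funP XY') mf fXY measurableT).
rewrite -(eq_measure_integral (pushforward P XY') (m1 := (mu \x nu)%E));
  last first.
  by move=> A mA _; exact: prodE.
rewrite -integral12_prod_meas1//.
transitivity (\int[mu]_x (x%:E * 'E_P[Y]))%E.
  apply: eq_integral => x _; rewrite /fubini_F -E1 ?Y2// -integralZl//.
  exact: I1.
have /Lfun2_Lfun1 Y1 := Y2.
rewrite -(fineK (expectation_fin_num Y1)) integralZr ?E1//.
exact: I1.
Qed.
End indep.

(** * Cross-covariance matrices of random vectors *)

Section xcov.
Context {R : realType} {d : measure_display} {Omega : measurableType d}.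
Variable P : probability Omega R.

Definition L2vec m (X : Omega -> 'cV[R]_m) : Prop :=
  forall i, (fun w => X w i ord0) \in Lfun P 2%:E.

Definition xcov m n (X : Omega -> 'cV[R]_m) (Z : Omega -> 'cV[R]_n)
    : 'M[R]_(m, n) :=
  \matrix_(i, j) rcov P (fun w => X w i ord0) (fun w => Z w j ord0).

Lemma CovE n (X : Omega -> 'cV[R]_n) : Cov P X = xcov X X.
Proof. by []. Qed.

Lemma Lfun2_sum (I : Type) (s : seq I) (F : I -> Omega -> R) :
  (forall i, F i \in Lfun P 2%:E) ->
  (fun w => \sum_(i <- s) F i w) \in Lfun P 2%:E.
Proof.
move=> F2; rewrite (_ : (fun w => _) = \sum_(i <- s) F i); last first.
  by apply/funext => w; rewrite fct_sumE.
by rewrite rpred_sum// lee1n.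
Qed.

Lemma rcov_suml (I : Type) (s : seq I) (F : I -> Omega -> R) Z :
  (forall i, F i \in Lfun P 2%:E) -> Z \in Lfun P 2%:E ->
  rcov P (fun w => \sum_(i <- s) F i w) Z = \sum_(i <- s) rcov P (F i) Z.
Proof.
move=> F2 Z2; elim: s => [|i s IH].
  rewrite big_nil (_ : (fun w => _) = cst 0) ?rcov_cstl//.
  by apply/funext => w; rewrite big_nil.
rewrite big_cons -IH -rcovDl//; last exact: Lfun2_sum.
by rewrite (_ : (fun w => _) = F i \+ (fun w => \sum_(i <- s) F i w))//;
  apply/funext => w; rewrite big_cons.
Qed.

Lemma L2vec_mul m n (A : 'M[R]_(m, n)) X :
  L2vec X -> L2vec (fun w => A *m X w).
Proof.
move=> X2 i.
rewrite (_ : (fun w => _) = (fun w => \sum_k A i k * X w k ord0)); last first.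
  by apply/funext => w; rewrite mxE.
by apply: Lfun2_sum => k; exact: Lfun2_scale.
Qed.

Lemma L2vecD m (X Y : Omega -> 'cV[R]_m) :
  L2vec X -> L2vec Y -> L2vec (fun w => X w + Y w).
Proof.
move=> X2 Y2 i; rewrite (_ : (fun w => _) =
  (fun w => X w i ord0) \+ (fun w => Y w i ord0)) ?Lfun2D//.
by apply/funext => w; rewrite mxE.
Qed.

Lemma L2vec_cst m (c : 'cV[R]_m) : L2vec (fun=> c).
Proof. by move=> i; exact: Lfun_cst. Qed.

Lemma L2vecN m (X : Omega -> 'cV[R]_m) : L2vec X -> L2vec (fun w => - X w).
Proof.
move=> X2; rewrite (_ : (fun w => _) = fun w => (- 1%:M) *m X w).
  exact: L2vec_mul.
by apply/funext => w; rewrite mulNmx mul1mx.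
Qed.

Lemma L2vecB m (X Y : Omega -> 'cV[R]_m) :
  L2vec X -> L2vec Y -> L2vec (fun w => X w - Y w).
Proof. by move=> X2 Y2; apply: L2vecD => //; exact: L2vecN. Qed.

Lemma tr_xcov m n (X : Omega -> 'cV[R]_m) (Z : Omega -> 'cV[R]_n) :
  (xcov X Z)^T = xcov Z X.
Proof. by apply/matrixP => i j; rewrite !mxE rcovC. Qed.

Lemma xcov_mull m n p (A : 'M[R]_(p, m)) (X : Omega -> 'cV[R]_m)
    (Z : Omega -> 'cV[R]_n) :
  L2vec X -> L2vec Z -> xcov (fun w => A *m X w) Z = A *m xcov X Z.
Proof.
move=> X2 Z2; apply/matrixP => i j; rewrite !mxE.
rewrite (_ : (fun w => _) = (fun w => \sum_k A i k * X w k ord0)); last first.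
  by apply/funext => w; rewrite mxE.
rewrite rcov_suml//; last by move=> k; exact: Lfun2_scale.
by apply: eq_bigr => k _; rewrite mxE rcovZl.
Qed.

Lemma xcovDl m n (X Y : Omega -> 'cV[R]_m) (Z : Omega -> 'cV[R]_n) :
  L2vec X -> L2vec Y -> L2vec Z ->
  xcov (fun w => X w + Y w) Z = xcov X Z + xcov Y Z.
Proof.
move=> X2 Y2 Z2; apply/matrixP => i j; rewrite !mxE -rcovDl//.
by congr (rcov P _ _); apply/funext => w; rewrite mxE.
Qed.

Lemma xcov_mulr m n p (B : 'M[R]_(p, n)) (X : Omega -> 'cV[R]_m)
    (Z : Omega -> 'cV[R]_n) :
  L2vec X -> L2vec Z -> xcov X (fun w => B *m Z w) = xcov X Z *m B^T.
Proof.
by move=> X2 Z2; rewrite -tr_xcov xcov_mull// trmx_mul tr_xcov.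
Qed.

Lemma xcovDr m n (X : Omega -> 'cV[R]_m) (Y Z : Omega -> 'cV[R]_n) :
  L2vec X -> L2vec Y -> L2vec Z ->
  xcov X (fun w => Y w + Z w) = xcov X Y + xcov X Z.
Proof.
by move=> X2 Y2 Z2; rewrite -tr_xcov xcovDl// linearD/= !tr_xcov.
Qed.

Lemma xcovNl m n (X : Omega -> 'cV[R]_m) (Z : Omega -> 'cV[R]_n) :
  L2vec X -> L2vec Z -> xcov (fun w => - X w) Z = - xcov X Z.
Proof.
move=> X2 Z2; rewrite (_ : (fun w => _) = fun w => (- 1%:M) *m X w).
  by rewrite xcov_mull// mulNmx mul1mx.
by apply/funext => w; rewrite mulNmx mul1mx.
Qed.

Lemma xcovBl m n (X Y : Omega -> 'cV[R]_m) (Z : Omega -> 'cV[R]_n) :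
  L2vec X -> L2vec Y -> L2vec Z ->
  xcov (fun w => X w - Y w) Z = xcov X Z - xcov Y Z.
Proof. by move=> *; rewrite xcovDl ?xcovNl//; exact: L2vecN. Qed.

Lemma xcovBr m n (X : Omega -> 'cV[R]_m) (Y Z : Omega -> 'cV[R]_n) :
  L2vec X -> L2vec Y -> L2vec Z ->
  xcov X (fun w => Y w - Z w) = xcov X Y - xcov X Z.
Proof.
by move=> X2 Y2 Z2; rewrite -tr_xcov xcovBl// linearB/= !tr_xcov.
Qed.

Lemma xcov_cstl m n (c : 'cV[R]_m) (Z : Omega -> 'cV[R]_n) :
  xcov (fun=> c) Z = 0.
Proof. by apply/matrixP => i j; rewrite !mxE; exact: rcov_cstl. Qed.

Lemma xcov_cstr m n (X : Omega -> 'cV[R]_m) (c : 'cV[R]_n) :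
  xcov X (fun=> c) = 0.
Proof. by rewrite -tr_xcov xcov_cstl trmx0. Qed.

Lemma nnegdef_xcov n (X : Omega -> 'cV[R]_n) :
  L2vec X -> nnegdefmx (xcov X X).
Proof.
move=> X2; split; first exact: tr_xcov.
move=> x; have X2' := L2vec_mul x^T X2.
have -> : x^T *m xcov X X *m x =
    xcov (fun w => x^T *m X w) (fun w => x^T *m X w).
  by rewrite xcov_mull// xcov_mulr// trmxK mulmxA.
by rewrite mxE; exact: rcov_ge0.
Qed.

(** If U is uncorrelated with V - U, then Cov V = Cov U + Cov (V - U). *)
Lemma loewner_orthogonal n (U V : Omega -> 'cV[R]_n) :
  L2vec U -> L2vec V -> xcov U V = xcov U U ->
  loewner_le (Cov P U) (Cov P V).
Proof.
move=> U2 V2 UV; rewrite /loewner_le !CovE.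
have VU : xcov V U = xcov U U by rewrite -tr_xcov UV tr_xcov.
have VU2 := L2vecB V2 U2.
have -> : xcov V V - xcov U U =
    xcov (fun w => V w - U w) (fun w => V w - U w).
  by rewrite xcovBl// !xcovBr// VU UV subrr subr0.
exact: nnegdef_xcov.
Qed.

End xcov.

(** * Covariance of Ito sums *)

Section ito.
Context {R : realType}.

(** The covariance of two Ito sums is such a Riemann sum, with evaluation at the
    left endpoints ([xcov_ito_ito]). *)
Definition rsum {V : lmodType R} (a : R) (s : seq R) (g : R -> V) : V :=
  \sum_(k < size s) (nth 0 s k - nth 0 (a :: s) k) *: g (nth 0 (a :: s) k).

Lemma rsum_cons (V : lmodType R) a t s (g : R -> V) :
  rsum a (t :: s) g = (t - a) *: g a + rsum t s g.
Proof. by rewrite /rsum big_ord_recl. Qed.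

Context {d : measure_display} {Omega : measurableType d}.

Lemma ito_sum_cons m n a t s (G : R -> 'M[R]_(m, n))
    (Y : R -> Omega -> 'cV[R]_n) (w : Omega) :
  ito_sum a (t :: s) G Y w = G a *m (Y t w - Y a w) + ito_sum t s G Y w.
Proof. by rewrite /ito_sum big_ord_recl. Qed.

Variable P : probability Omega R.
Variables (a b : R) (n : nat) (K : 'M[R]_n) (Y : R -> Omega -> 'cV[R]_n).
Hypothesis Y2 : forall t, t \in `[a, b] -> L2vec P (Y t).
Hypothesis covY : forall s t, s \in `[a, b] -> t \in `[a, b] ->
  xcov P (Y s) (Y t) = Num.min s t *: K.

Lemma L2vec_ito m (G : R -> 'M[R]_(m, n)) c s :
  a <= c -> itv_partition c b s -> L2vec P (ito_sum c s G Y).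
Proof.
elim: s c => [|t s IH] c ac cs.
  rewrite (_ : ito_sum _ _ _ _ = fun=> 0); first exact: L2vec_cst.
  by apply/funext => w; rewrite /ito_sum big_ord0.
have tb := itv_partition_le (itv_partition_cons cs).
have ct : c < t by case: cs => /= /andP[].
rewrite (_ : ito_sum _ _ _ _ =
  fun w => G c *m (Y t w - Y c w) + ito_sum t s G Y w); last first.
  by apply/funext => w; rewrite ito_sum_cons.
apply: L2vecD; last by apply: IH (itv_partition_cons cs); lra.
apply: L2vec_mul; apply: L2vecB; apply: Y2; rewrite in_itv/=.
  by apply/andP; split; lra.
by apply/andP; split; lra.
Qed.

(** Increments after time c are uncorrelated with Y(u) for u <= c, because
    min(u, t) - min(u, c) = 0 for t >= c. *)
Lemma xcov_past_ito m (G : R -> 'M[R]_(m, n)) u c s :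
  a <= u -> u <= c -> itv_partition c b s -> xcov P (Y u) (ito_sum c s G Y) = 0.
Proof.
elim: s c => [|t s IH] c au uc cs.
  rewrite (_ : ito_sum _ _ _ _ = fun=> 0); first exact: xcov_cstr.
  by apply/funext => w; rewrite /ito_sum big_ord0.
have tb := itv_partition_le (itv_partition_cons cs).
have ct : c < t by case: cs => /= /andP[].
rewrite (_ : ito_sum _ _ _ _ =
  fun w => G c *m (Y t w - Y c w) + ito_sum t s G Y w); last first.
  by apply/funext => w; rewrite ito_sum_cons.
have tab : t \in `[a, b] by rewrite in_itv/=; apply/andP; split; lra.
have uab : u \in `[a, b] by rewrite in_itv/=; apply/andP; split; lra.
have cab : c \in `[a, b] by rewrite in_itv/=; apply/andP; split; lra.
have d2 : L2vec P (fun w => Y t w - Y c w) by apply: L2vecB; exact: Y2.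
rewrite xcovDr ?IH ?addr0//; [|lra|exact: itv_partition_cons cs|exact: Y2
  |exact: L2vec_mul|by apply: L2vec_ito (itv_partition_cons cs); lra].
rewrite xcov_mulr ?xcovBr ?covY//; try exact: Y2.
rewrite !min_l; [|lra..].
by rewrite subrr mul0mx.
Qed.

(** The Ito isometry for sums. By induction on the partition: the first
    increment is uncorrelated with the later ones, and its own covariance is
    (t - c) K. *)
Lemma xcov_ito_ito m1 m2 (G : R -> 'M[R]_(m1, n)) (H : R -> 'M[R]_(m2, n)) c s :
  a <= c -> itv_partition c b s ->
  xcov P (ito_sum c s G Y) (ito_sum c s H Y) =
  rsum c s (fun t => G t *m K *m (H t)^T).
Proof.
elim: s c => [|t s IH] c ac cs.
  rewrite /rsum big_ord0.
  rewrite (_ : ito_sum _ _ _ _ = fun=> 0); first exact: xcov_cstl.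
  by apply/funext => w; rewrite /ito_sum big_ord0.
have cs' := itv_partition_cons cs.
have tb := itv_partition_le cs'.
have ct : c < t by case: cs => /= /andP[].
have tab : t \in `[a, b] by rewrite in_itv/=; apply/andP; split; lra.
have cab : c \in `[a, b] by rewrite in_itv/=; apply/andP; split; lra.
have d2 : L2vec P (fun w => Y t w - Y c w) by apply: L2vecB; exact: Y2.
have E k (F : R -> 'M[R]_(k, n)) : ito_sum c (t :: s) F Y =
    fun w => F c *m (Y t w - Y c w) + ito_sum t s F Y w.
  by apply/funext => w; rewrite ito_sum_cons.
have I2 k (F : R -> 'M[R]_(k, n)) : L2vec P (ito_sum t s F Y).
  by apply: L2vec_ito => //; lra.
have F2 k (F : 'M[R]_(k, n)) : L2vec P (fun w => F *m (Y t w - Y c w)).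
  exact: L2vec_mul.
have Fi k l (F : 'M[R]_(k, n)) (F' : R -> 'M[R]_(l, n)) :
    xcov P (fun w => F *m (Y t w - Y c w)) (ito_sum t s F' Y) = 0.
  rewrite xcov_mull// xcovBl//; try exact: Y2.
  by rewrite !xcov_past_ito// ?subrr ?mulmx0//; lra.
have tct :
    xcov P (fun w => Y t w - Y c w) (fun w => Y t w - Y c w) = (t - c) *: K.
  have Yt2 := Y2 tab; have Yc2 := Y2 cab.
  rewrite xcovBl ?xcovBr// !covY// !minxx (min_r (ltW ct)) (min_l (ltW ct)).
  by rewrite subrr subr0 scalerBl.
rewrite !E rsum_cons -IH//; last lra.
rewrite xcovDl//; last exact: L2vecD.
rewrite !xcovDr// !Fi addr0 -[X in _ + (X + _)]tr_xcov Fi trmx0 add0r.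
by rewrite xcov_mull// xcov_mulr// tct -scalemxAl -scalemxAr mulmxA.
Qed.

End ito.

(** * Partitions and Riemann sums *)

Section partitions.
Context {R : realType}.

Lemma mesh_lt_cons (a t : R) s delta :
  t - a < delta -> mesh_lt t s delta -> mesh_lt a (t :: s) delta.
Proof. by move=> ta ts [|k]//= /ts. Qed.

Lemma mesh_lt_behead (a t : R) s delta :
  mesh_lt a (t :: s) delta -> t - a < delta /\ mesh_lt t s delta.
Proof.
by move=> ts; split; [exact: (ts 0%N)|move=> k ks; exact: (ts k.+1)].
Qed.

(** Steps of length delta / 2 are made as long as at least delta remains; the
    induction is on an upper bound of the number of steps. *)
Lemma exists_fine_partition (a b delta : R) : a < b -> 0 < delta ->
  exists2 s, itv_partition a b s & mesh_lt a s delta.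
Proof.
move=> ab delta0.
pose n := Num.truncn ((b - a) / (delta / 2)).
have : b - a < n.+1%:R * (delta / 2).
  by rewrite -ltr_pdivrMr ?divr_gt0// truncnS_gt.
move: n.+1 => {n} n; elim: n a ab => [|m IH] a ab ban.
  by move: ban; rewrite mul0r; lra.
have [bad|bad] := ltP (b - a) delta.
  by exists [:: b]; [exact: itv_partition1|exact: mesh_lt_cons].
have [||s [sp /eqP sb] sm] := IH (a + delta / 2); first lra.
  by move: ban; rewrite -natr1 mulrDl mul1r; lra.
exists (a + delta / 2 :: s); last by apply: mesh_lt_cons => //; lra.
by split; rewrite /= ?sb// sp andbT; lra.
Qed.

End partitions.

Section riemann.
Context {R : realType}.
Local Notation mu := (@lebesgue_measure R).
Implicit Types (a b : R) (g : R -> R).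

Lemma within_itv_continuous_dist a b g : {within `[a, b], continuous g} ->
  forall x, x \in `[a, b] -> forall e, 0 < e -> exists2 r : R, 0 < r &
    forall y, y \in `[a, b] -> `|x - y| < r -> `|g x - g y| < e.
Proof.
move=> /subspace_continuousP gc x xab e e0.
have /cvgrPdist_lt/(_ e e0) := gc x xab.
rewrite near_withinE => /nbhs_ballP[r r0 xr]; exists r => // y yab xy.
exact: xr.
Qed.

(** Heine's theorem, by compactness: the property to be spread over [a, b] is
    that a given delta works at a point, for delta close to 0. *)
Lemma uniformly_continuous_itv a b g : {within `[a, b], continuous g} ->
  forall e, 0 < e -> exists2 delta : R, 0 < delta &
    forall x y, x \in `[a, b] -> y \in `[a, b] -> `|x - y| < delta ->
      `|g x - g y| < e.
Proof.
move=> gc e e0.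
have H x : `[a, b]%classic x -> \forall x' \near x & delta \near 0^'+,
    `[a, b]%classic x' -> forall y, y \in `[a, b] ->
    `|x' - y| < delta -> `|g x' - g y| < e.
  move=> xab; have e2 : 0 < e / 2 by lra.
  have [r r0 xr] := within_itv_continuous_dist gc xab e2.
  have r2 : 0 < r / 2 by lra.
  near=> x' delta => x'ab y yab x'y.
  have xx' : `|x - x'| < r / 2 by near: x'; exact: nbhsx_ballx.
  have dr : delta < r / 2 by near: delta; exact: nbhs_right_lt.
  have h1 := xr _ x'ab (lt_trans xx' _).
  have h2 : `|g x - g y| < e / 2.
    apply: xr => //; rewrite (_ : x - y = (x - x') + (x' - y)); last by ring.
    apply: le_lt_trans (ler_normD _ _) _; rewrite (splitr r).
    by apply: ltrD => //; exact: lt_trans x'y dr.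
  have {}h1 : `|g x - g x'| < e / 2.
    by apply: h1; rewrite ltr_pdivrMr // ltr_pMr // ltr1n.
  rewrite (_ : g x' - g y = (g x - g y) - (g x - g x')); last by ring.
  by apply: le_lt_trans (ler_normB _ _) _; rewrite (splitr e) ltrD.
have /compact_near_coveringP/near_covering_withinP := @segment_compact R a b.
move=> /(_ _ (0^'+) (fun delta x => forall y, y \in `[a, b] ->
  `|x - y| < delta -> `|g x - g y| < e) _ H) [r /= r0 rP].
exists (r / 2); first lra.
move=> x y xab yab xy; apply: (rP (r / 2)) => //; last lra.
by rewrite /= sub0r normrN gtr0_norm; lra.
Unshelve. all: by end_near. Qed.

Lemma within_itv_integrable a b g : {within `[a, b], continuous g} ->
  mu.-integrable `[a, b] (EFin \o g).
Proof.
move=> gc; apply: continuous_compact_integrable => //.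
exact: segment_compact.
Qed.

Lemma Rintegral_itv_split a t b g : a <= t -> t <= b ->
  {within `[a, b], continuous g} ->
  \int[mu]_(x in `[a, b]) g x =
  \int[mu]_(x in `[a, t]) g x + \int[mu]_(x in `[t, b]) g x.
Proof.
move=> at_ tb gc; have gi := within_itv_integrable gc.
have := @Rintegral_itvB R g (BLeft a) (BRight b) t gi.
rewrite !bnd_simp => /(_ at_ tb)/eqP; rewrite subr_eq addrC => /eqP ->.
rewrite Rintegral_itv_obnd_cbnd//.
by apply: integrableS gi => //; apply: subset_itvr; rewrite bnd_simp.
Qed.

Lemma le_normr_Rintegral_itv a b g (e : R) : a <= b ->
  {within `[a, b], continuous g} ->
  (forall x, x \in `[a, b] -> `|g x| <= e) ->
  `|\int[mu]_(x in `[a, b]) g x| <= e * (b - a).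
Proof.
move=> ab gc ge; have gi := within_itv_integrable gc.
apply: le_trans (le_normr_Rintegral _ gi) _ => //.
have -> : e * (b - a) = \int[mu]_(x in `[a, b]) (cst e x).
  rewrite Rintegral_cst//= lebesgue_measure_itv/= lte_fin.
  by case: ltgtP ab => // -> _; rewrite subrr.
apply: le_Rintegral => //; first exact: (integrable_norm gi).
by apply: within_itv_integrable => x; exact: cvg_cst.
Qed.

(** By uniform continuity one delta serves every partition of small mesh; the
    induction splits off the first interval [c, t], where g differs from g c by
    less than e. *)
Lemma riemann_sum_close a b g : {within `[a, b], continuous g} ->
  forall e, 0 < e -> exists2 delta : R, 0 < delta &
    forall s, itv_partition a b s -> mesh_lt a s delta ->
      `|\int[mu]_(x in `[a, b]) g x - rsum a s g| <= e * (b - a).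
Proof.
move=> gc e e0; have [delta delta0 gd] := uniformly_continuous_itv gc e0.
exists delta => // s.
suff H c : a <= c -> itv_partition c b s -> mesh_lt c s delta ->
    `|\int[mu]_(x in `[c, b]) g x - rsum c s g| <= e * (b - c) by exact: H.
elim: s c => [|t s IH] c ac cs sm.
  rewrite (itv_partition_nil cs) set_itv1 Rintegral_set1 /rsum big_ord0.
  by rewrite !subrr mulr0 normr0.
have cs' := itv_partition_cons cs; have [tc sm'] := mesh_lt_behead sm.
have tb := itv_partition_le cs'.
have ct : c < t by case: cs => /= /andP[].
have gS u v : a <= u -> v <= b -> {within `[u, v], continuous g}.
  move=> au vb; apply: continuous_subspaceW gc; apply: subset_itv;
  by rewrite bnd_simp.
rewrite (@Rintegral_itv_split c t b)//; [|lra|exact: gS].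
rewrite rsum_cons.
have at_ : a <= t by lra.
have {}IH := IH t at_ cs' sm'.
have cg : {within `[c, t], continuous (fun x => g x - g c)}.
  by apply: within_continuousB; [exact: gS|move=> x; exact: cvg_cst].
have h : `|\int[mu]_(x in `[c, t]) (g x - g c)| <= e * (t - c).
  apply: le_normr_Rintegral_itv => // [|x xct]; first exact: ltW.
  have /andP[xc xt] : (c <= x) && (x <= t) by move: xct; rewrite in_itv.
  apply/ltW/gd; rewrite ?in_itv/=; [by apply/andP; split; lra..|].
  by rewrite ger0_norm; lra.
have E : \int[mu]_(x in `[c, t]) (g x - g c) =
    \int[mu]_(x in `[c, t]) g x - (t - c) * g c.
  rewrite RintegralB//; [|by apply: within_itv_integrable; exact: gS
    |by apply: within_itv_integrable => x; exact: cvg_cst].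
  congr (_ - _); rewrite Rintegral_cst//= lebesgue_measure_itv/= lte_fin ct/=.
  by rewrite mulrC.
rewrite [X in `|X|](_ : _ = (\int[mu]_(x in `[c, t]) g x - (t - c) * g c) +
  (\int[mu]_(x in `[t, b]) g x - rsum t s g)); last first.
  by rewrite /GRing.scale/=; ring.
rewrite -E; apply: le_trans (ler_normD _ _) _; lra.
Qed.

(** As g is nonnegative, its integral over [a, y] is 0 for all y, and the
    derivative of this integral at y is g y. *)
Lemma Rintegral_continuous_eq0 a b g : a < b ->
  {within `[a, b], continuous g} ->
  (forall x, x \in `[a, b] -> 0 <= g x) ->
  \int[mu]_(x in `[a, b]) g x = 0 -> forall x, x \in `]a, b[ -> g x = 0.
Proof.
move=> ab gc g0 ig x; rewrite in_itv/= => /andP[ax xb].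
have gi := within_itv_integrable gc.
pose F y := \int[mu]_(t in `[a, y]) g t.
have gS u v : a <= u -> v <= b -> {within `[u, v], continuous g}.
  move=> au vb; apply: continuous_subspaceW gc; apply: subset_itv;
  by rewrite bnd_simp.
have F0 y : y \in `]a, b[ -> F y = 0.
  rewrite in_itv/= => /andP[ay yb].
  have := @Rintegral_itv_split a y b g (ltW ay) (ltW yb) gc.
  rewrite ig => /esym.
  have h1 : 0 <= F y.
    apply: Rintegral_ge0 => z /=; rewrite in_itv/= => /andP[az zy]; apply: g0.
    by rewrite in_itv/=; apply/andP; split; lra.
  have h2 : 0 <= \int[mu]_(x in `[y, b]) g x.
    apply: Rintegral_ge0 => z /=; rewrite in_itv/= => /andP[az zy]; apply: g0.
    by rewrite in_itv/=; apply/andP; split; lra.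
  by move=> e1; apply/eqP; rewrite eq_le h1 andbT -[leRHS]e1 lerDl.
have gx : {for x, continuous g}.
  by apply: within_continuous_continuous gc _; rewrite ?in_itv/= ?ax.
have [_ <-] := continuous_FTC1_closed xb gi ax gx.
rewrite derive1E (near_eq_derive _ (g := cst 0)) ?derive_cst//.
have : x \in `]a, b[ by rewrite in_itv/= ax.
move=> /near_in_itvoo; apply: filterS => y; exact: F0.
Qed.

End riemann.

(** * The Ito isometry *)

Section stoch_int.
Context {R : realType}.

Lemma eq0_le_eps (x C : R) : 0 <= C ->
  (forall e, 0 < e -> e <= 1 -> `|x| <= e * C) -> x = 0.
Proof.
move=> C0 xC; apply/eqP; rewrite -normr_le0 leNgt; apply/negP => x0.
pose e := Num.min 1 (`|x| / (2 * (C + 1))).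
have C1 : 0 < C + 1 by lra.
have e0 : 0 < e by rewrite lt_min ltr01 divr_gt0// mulr_gt0.
have e1 : e <= 1 by rewrite ge_min lexx.
have ex : e * (2 * (C + 1)) <= `|x|.
  by rewrite -ler_pdivlMr ?mulr_gt0// ge_min lexx orbT.
have := xC e e0 e1.
by clearbody e; nra.
Qed.

Context {d : measure_display} {Omega : measurableType d}.
Variable P : probability Omega R.

Lemma Lfun2B (X Y : Omega -> R) : X \in Lfun P 2%:E -> Y \in Lfun P 2%:E ->
  X \- Y \in Lfun P 2%:E.
Proof. by move=> X2 Y2; rewrite rpredB// lee1n. Qed.

(** Continuity of the covariance in L^2. With U' = U + D and V' = V + D', the
    difference is cov(U, D') + cov(D, V) + cov(D, D'), and [rcov_young] with
    weight e bounds each term by a multiple of e. *)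
Lemma rcov_approx (U V U' V' : Omega -> R) e : 0 < e -> e <= 1 ->
  U \in Lfun P 2%:E -> V \in Lfun P 2%:E ->
  U' \in Lfun P 2%:E -> V' \in Lfun P 2%:E ->
  ('E_P[(fun w => ((U' w - U w) ^+ 2)%R)] < (e ^+ 2)%:E)%E ->
  ('E_P[(fun w => ((V' w - V w) ^+ 2)%R)] < (e ^+ 2)%:E)%E ->
  `|rcov P U V - rcov P U' V'| <= e * (rcov P U U + rcov P V V + 4).
Proof.
move=> e0 e1 U2 V2 U'2 V'2 UU' VV'.
pose D := U' \- U; pose D' := V' \- V.
have D2 : D \in Lfun P 2%:E by exact: Lfun2B.
have D'2 : D' \in Lfun P 2%:E by exact: Lfun2B.
have vD : rcov P D D <= e ^+ 2 by exact: rcov_le_sqr.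
have vD' : rcov P D' D' <= e ^+ 2 by exact: rcov_le_sqr.
have UE : U' = U \+ D by apply/funext => w; rewrite /D/= addrC subrK.
have VE : V' = V \+ D' by apply/funext => w; rewrite /D'/= addrC subrK.
clearbody D D'.
have -> : rcov P U V - rcov P U' V' =
    - (rcov P U D' + rcov P V D + rcov P D D').
  rewrite UE VE rcovDl ?Lfun2D// (rcovC P U (V \+ D')) (rcovC P D (V \+ D')).
  rewrite !rcovDl//.
  by rewrite (rcovC _ V U) (rcovC _ D' U) (rcovC _ D' D); ring.
have h1 := rcov_young e0 U2 D'2.
have h2 := rcov_young e0 V2 D2.
have h3 := rcov_young ltr01 D2 D'2.
have ee x : x <= e ^+ 2 -> e^-1 * x <= e.
  by move=> xe; rewrite ler_pdivrMl// -expr2.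
have {}h1 := le_trans h1 (lerD (lexx _) (ee _ vD')).
have {}h2 := le_trans h2 (lerD (lexx _) (ee _ vD)).
rewrite invr1 !mul1r in h3.
have e2 : e ^+ 2 <= e by rewrite expr2; nra.
rewrite normrN.
apply: le_trans (ler_normD _ _) _.
apply: le_trans (lerD (ler_normD _ _) (lexx _)) _.
lra.
Qed.

Variables (a b : R) (n : nat) (K : 'M[R]_n) (Y : R -> Omega -> 'cV[R]_n).
Hypothesis ab : a < b.
Hypothesis Y2 : forall t, t \in `[a, b] -> L2vec P (Y t).
Hypothesis covY : forall s t, s \in `[a, b] -> t \in `[a, b] ->
  xcov P (Y s) (Y t) = Num.min s t *: K.

(** A measurable I at finite L^2 distance from an Ito sum is square
    integrable. *)
Lemma L2vec_stoch_int m (G : R -> 'M[R]_(m, n)) I :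
  is_stoch_int P a b G Y I -> L2vec P I.
Proof.
move=> GI i; have [mI /(_ 1 ltr01)[delta delta0 dI]] := GI i.
have [s sp sm] := exists_fine_partition ab delta0.
have := dI s sp sm; set X := fun w => _ => X1.
have S2 := L2vec_ito Y2 G (lexx a) sp i.
have X2 : (fun w => ito_sum a s G Y w i ord0 - I w i ord0) \in Lfun P 2%:E.
  apply: sqr_expectation_Lfun2; last exact: lt_trans X1 (ltry _).
  apply: measurable_funB => //.
  by move: S2; rewrite inE => /andP[]; rewrite inE.
have := Lfun2B S2 X2.
rewrite (_ : _ \- _ = fun w => I w i ord0)//.
by apply/funext => w /=; rewrite opprB addrC subrK.
Qed.

Lemma xcov_stoch_int_init m (G : R -> 'M[R]_(m, n)) I :
  is_stoch_int P a b G Y I -> xcov P (Y a) I = 0.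
Proof.
move=> GI; apply/matrixP => k i; rewrite !mxE.
have I2 := L2vec_stoch_int GI i.
have Ya2 : (fun w => Y a w k ord0) \in Lfun P 2%:E.
  by apply: Y2; rewrite in_itv/= lexx ltW.
have [_ dI] := GI i.
apply: (@eq0_le_eps _ (rcov P (fun w => Y a w k ord0) (fun w => Y a w k ord0) +
   rcov P (fun w => I w i ord0) (fun w => I w i ord0) + 4)).
  by rewrite !addr_ge0// rcov_ge0.
move=> e e0 e1; have e20 : 0 < e ^+ 2 by rewrite exprn_gt0.
have [delta delta0 {}dI] := dI _ e20.
have [s sp sm] := exists_fine_partition ab delta0.
have S2 := L2vec_ito Y2 G (lexx a) sp i.
have := rcov_approx e0 e1 Ya2 I2 Ya2 S2 _ (dI s sp sm).
have -> : rcov P (fun w => Y a w k ord0)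
    (fun w => ito_sum a s G Y w i ord0) = 0.
  have := xcov_past_ito Y2 covY G (lexx a) (lexx a) sp.
  by move=> /matrixP/(_ k i); rewrite !mxE.
rewrite subr0; apply.
rewrite (_ : (fun w => _) = cst 0) ?expectation_cst ?lte_fin//.
by apply/funext => w; rewrite subrr expr0n.
Qed.

(** The partition is taken fine enough for the two Ito sums and for the Riemann
    sum at once. *)
Lemma xcov_stoch_int m1 m2 (G : R -> 'M[R]_(m1, n)) (H : R -> 'M[R]_(m2, n))
    I J :
  (forall i j, {within `[a, b], continuous
    (fun t => (G t *m K *m (H t)^T) i j)}) ->
  is_stoch_int P a b G Y I -> is_stoch_int P a b H Y J ->
  xcov P I J = intmx a b (fun t => G t *m K *m (H t)^T).
Proof.
move=> cGH GI HJ; apply/matrixP => i j; rewrite !mxE.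
apply/eqP; rewrite -subr_eq0; apply/eqP.
have I2 := L2vec_stoch_int GI i; have J2 := L2vec_stoch_int HJ j.
have [_ dI] := GI i; have [_ dJ] := HJ j.
apply: (@eq0_le_eps _ (rcov P (fun w => I w i ord0) (fun w => I w i ord0) +
   rcov P (fun w => J w j ord0) (fun w => J w j ord0) + 4 + (b - a))).
  apply: addr_ge0; last by rewrite subr_ge0 ltW.
  by rewrite !addr_ge0// rcov_ge0.
move=> e e0 e1; have e20 : 0 < e ^+ 2 by rewrite exprn_gt0.
have [d1 d10 {}dI] := dI _ e20.
have [d2 d20 {}dJ] := dJ _ e20.
have [d3 d30 dR] := riemann_sum_close (cGH i j) e0.
have dmin : 0 < Num.min d1 (Num.min d2 d3) by rewrite !lt_min d10 d20.
have [s sp sm] := exists_fine_partition ab dmin.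
have sm1 : mesh_lt a s d1 by move=> k /sm; rewrite !lt_min => /and3P[].
have sm2 : mesh_lt a s d2 by move=> k /sm; rewrite !lt_min => /and3P[].
have sm3 : mesh_lt a s d3 by move=> k /sm; rewrite !lt_min => /and3P[].
have SG2 := L2vec_ito Y2 G (lexx a) sp i.
have SH2 := L2vec_ito Y2 H (lexx a) sp j.
have h1 := rcov_approx e0 e1 I2 J2 SG2 SH2 (dI s sp sm1) (dJ s sp sm2).
have h2 := dR s sp sm3.
have E : rcov P (fun w => ito_sum a s G Y w i ord0)
      (fun w => ito_sum a s H Y w j ord0) =
    rsum a s (fun t => (G t *m K *m (H t)^T) i j).
  have := xcov_ito_ito Y2 covY G H (lexx a) sp.
  move=> /matrixP/(_ i j); rewrite [LHS]mxE => ->.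
  by rewrite summxE; apply: eq_bigr => k _; rewrite mxE.
rewrite E in h1; rewrite distrC in h2.
rewrite mulrDr; apply: le_trans (lerD h1 h2).
apply: le_trans (ler_normD _ _); rewrite le_eqVlt; apply/orP; left; apply/eqP.
by congr (`| _ |); rewrite addrA subrK.
Qed.

End stoch_int.

(** * Integration and differentiation of matrix-valued functions *)

Section matrix_calculus.
Context {R : realType}.
Local Notation mu := (@lebesgue_measure R).
Variables a b : R.

Definition mxcont m n (G : R -> 'M[R]_(m, n)) : Prop :=
  forall i j, {within `[a, b], continuous (fun t => G t i j)}.

Lemma within_continuous_sum (I : Type) (s : seq I) (F : I -> R -> R) :
  (forall i, {within `[a, b], continuous (F i)}) ->
  {within `[a, b], continuous (fun t => \sum_(i <- s) F i t)}.
Proof.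
move=> Fc; elim: s => [|i s IH].
  rewrite (_ : (fun t => _) = cst 0); first by move=> x; exact: cvg_cst.
  by apply/funext => t; rewrite big_nil.
rewrite (_ : (fun t => _) = F i \+ (fun t => \sum_(i <- s) F i t)).
  exact: within_continuousD.
by apply/funext => t; rewrite big_cons.
Qed.

Lemma mxcont_mul m n p (G : R -> 'M[R]_(m, n)) (H : R -> 'M[R]_(n, p)) :
  mxcont G -> mxcont H -> mxcont (fun t => G t *m H t).
Proof.
move=> Gc Hc i j.
rewrite (_ : (fun t => _) = fun t => \sum_k G t i k * H t k j).
  by apply: within_continuous_sum => k x; apply: cvgM; [exact: Gc|exact: Hc].
by apply/funext => t; rewrite mxE.
Qed.

Lemma mxcont_tr m n (G : R -> 'M[R]_(m, n)) :
  mxcont G -> mxcont (fun t => (G t)^T).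
Proof.
move=> Gc i j; rewrite (_ : (fun t => _) = fun t => G t j i)//.
by apply/funext => t; rewrite mxE.
Qed.

Lemma mxcont_cst m n (A : 'M[R]_(m, n)) : mxcont (fun=> A).
Proof. by move=> i j x; exact: cvg_cst. Qed.

Lemma mxcont_dmx m n (F : R -> 'M[R]_(m, n)) : C1mx a b F -> mxcont (dmx a b F).
Proof.
move=> FC i j; rewrite (_ : (fun t => _) = dot a b (fun t => F t i j)).
  by case: (FC i j).
by apply/funext => t; rewrite mxE.
Qed.

Lemma Rintegral_sum_itv (I : Type) (s : seq I) (F : I -> R -> R) :
  (forall i, {within `[a, b], continuous (F i)}) ->
  \int[mu]_(t in `[a, b]) (\sum_(i <- s) F i t) =
  \sum_(i <- s) \int[mu]_(t in `[a, b]) F i t.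
Proof.
move=> Fc; elim: s => [|i s IH].
  rewrite big_nil; under eq_Rintegral do rewrite big_nil.
  by rewrite Rintegral_cst// mul0r.
rewrite big_cons -IH -RintegralD//; last 2 first.
- exact: within_itv_integrable.
- by apply: within_itv_integrable; exact: within_continuous_sum.
by apply: eq_Rintegral => t _; rewrite big_cons.
Qed.

Lemma intmx_mull m n p (A : 'M[R]_(m, n)) (G : R -> 'M[R]_(n, p)) :
  mxcont G -> intmx a b (fun t => A *m G t) = A *m intmx a b G.
Proof.
move=> Gc; apply/matrixP => i j; rewrite !mxE.
under eq_Rintegral do rewrite mxE.
rewrite Rintegral_sum_itv; last first.
  by move=> k x; apply: cvgM; [exact: cvg_cst|exact: Gc].
apply: eq_bigr => k _; rewrite RintegralZl ?mxE//.
exact: within_itv_integrable.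
Qed.

Lemma tr_intmx m n (G : R -> 'M[R]_(m, n)) :
  (intmx a b G)^T = intmx a b (fun t => (G t)^T).
Proof.
by apply/matrixP => i j; rewrite !mxE; apply: eq_Rintegral => t _; rewrite mxE.
Qed.

Lemma intmx_mulr m n p (A : 'M[R]_(n, p)) (G : R -> 'M[R]_(m, n)) :
  mxcont G -> intmx a b (fun t => G t *m A) = intmx a b G *m A.
Proof.
move=> Gc; apply: trmx_inj; rewrite trmx_mul !tr_intmx -intmx_mull.
  by congr intmx; apply/funext => t; rewrite trmx_mul.
exact: mxcont_tr.
Qed.

Lemma eq_intmx m n (G H : R -> 'M[R]_(m, n)) :
  (forall t, t \in `[a, b] -> G t = H t) -> intmx a b G = intmx a b H.
Proof.
move=> GH; apply/matrixP => i j; rewrite !mxE; apply: eq_Rintegral => t.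
by rewrite inE/= => tab; rewrite GH.
Qed.

End matrix_calculus.

Section one_sided_derivative.
Context {R : realType}.
Variables a b : R.
Hypothesis ab : a < b.
Local Notation dfilter t := (within `[a, b]%classic t^').

(** Every point of [a, b], including the two ends, is a limit of other points of
    [a, b], so that limits of difference quotients are unique. *)
Lemma punctured_itv_proper t : t \in `[a, b] -> ProperFilter (dfilter t).
Proof.
rewrite in_itv/= => /andP[at_ tb]; apply: Build_ProperFilter_ex.
move=> A; rewrite /dnbhs !withinE => -[U [V /nbhs_ballP[r /= r0 rV] VU] UA].
suff [s [sab st] ts] : exists2 s : R, s \in `[a, b] /\ s != t & `|t - s| < r.
  exists s; have : (A `&` `[a, b]%classic) s; last by case.
  rewrite UA; split => //.
  have : (U `&` (fun x => x != t)) s by rewrite VU; split => //; exact: rV.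
  by case.
have [tltb|bt] := ltP t b.
  exists (t + Num.min (r / 2) (b - t)).
    have : 0 < Num.min (r / 2) (b - t) by rewrite lt_min divr_gt0//= subr_gt0.
    have : Num.min (r / 2) (b - t) <= b - t by rewrite ge_min lexx orbT.
    move: (Num.min _ _) => u ub u0; split; last by rewrite gt_eqF//; lra.
    by rewrite in_itv/=; apply/andP; split; lra.
  have : 0 < Num.min (r / 2) (b - t) by rewrite lt_min divr_gt0//= subr_gt0.
  have : Num.min (r / 2) (b - t) <= r / 2 by rewrite ge_min lexx.
  by move: (Num.min _ _) => u ub u0; rewrite distrC ger0_norm; lra.
have -> : t = b by lra.
exists (b - Num.min (r / 2) (b - a)).
  have : 0 < Num.min (r / 2) (b - a) by rewrite lt_min divr_gt0//= subr_gt0.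
  have : Num.min (r / 2) (b - a) <= b - a by rewrite ge_min lexx orbT.
  move: (Num.min _ _) => u ub u0; split; last by rewrite lt_eqF//; lra.
  by rewrite in_itv/=; apply/andP; split; lra.
have : 0 < Num.min (r / 2) (b - a) by rewrite lt_min divr_gt0//= subr_gt0.
have : Num.min (r / 2) (b - a) <= r / 2 by rewrite ge_min lexx.
by move: (Num.min _ _) => u ub u0; rewrite ger0_norm; lra.
Qed.

Lemma dot_cvg f t : C1 a b f -> t \in `[a, b] ->
  diff_quot f t s @[s --> dfilter t] --> dot a b f t.
Proof. by move=> [fd _] /fd. Qed.

Lemma dot_eq f t (l : R) : t \in `[a, b] ->
  diff_quot f t s @[s --> dfilter t] --> l -> dot a b f t = l.
Proof.
by move=> tab fl; have := punctured_itv_proper tab => ?; apply: cvg_lim.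
Qed.

Lemma C1_of_derivative f g : {within `[a, b], continuous g} ->
  (forall t, t \in `[a, b] -> diff_quot f t s @[s --> dfilter t] --> g t) ->
  C1 a b f.
Proof.
move=> gc fg; split=> [t tab|]; first by apply/cvg_ex; exists (g t); exact: fg.
apply: subspace_eq_continuous gc => t; rewrite inE/= => tab.
by apply/esym; exact: (dot_eq tab (fg t tab)).
Qed.

(** Finite linear combinations are treated at once, as this is the form of the
    entries of a matrix product. *)
Lemma diff_quot_cvg_lin (I : Type) (s : seq I) (c : I -> R)
    (f : I -> R -> R) t :
  t \in `[a, b] -> (forall i, C1 a b (f i)) ->
  diff_quot (fun x => \sum_(i <- s) c i * f i x) t x @[x --> dfilter t] -->
  \sum_(i <- s) c i * dot a b (f i) t.
Proof.
move=> tab fC; have tp := punctured_itv_proper tab.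
have -> : diff_quot (fun x => \sum_(i <- s) c i * f i x) t =
    fun x => \sum_(i <- s) c i * diff_quot (f i) t x.
  apply/funext => x; rewrite /diff_quot -sumrB mulr_suml.
  by apply: eq_bigr => i _; rewrite -mulrBr mulrA.
elim: s => [|i s IH].
  rewrite big_nil; under eq_fun do rewrite big_nil; exact: cvg_cst.
rewrite big_cons; under eq_fun do rewrite big_cons.
apply: cvgD IH; apply: cvgM; [exact: cvg_cst|exact: dot_cvg].
Qed.

Lemma C1_lin (I : Type) (s : seq I) (c : I -> R) (f : I -> R -> R) :
  (forall i, C1 a b (f i)) -> C1 a b (fun x => \sum_(i <- s) c i * f i x).
Proof.
move=> fC.
apply: (@C1_of_derivative _ (fun t => \sum_(i <- s) c i * dot a b (f i) t)).
  apply: within_continuous_sum => i x; apply: cvgM; first exact: cvg_cst.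
  by case: (fC i) => _; exact.
by move=> t tab; exact: diff_quot_cvg_lin.
Qed.

Lemma dot_lin (I : Type) (s : seq I) (c : I -> R) (f : I -> R -> R) t :
  t \in `[a, b] -> (forall i, C1 a b (f i)) ->
  dot a b (fun x => \sum_(i <- s) c i * f i x) t =
  \sum_(i <- s) c i * dot a b (f i) t.
Proof. by move=> tab fC; apply: dot_eq => //; exact: diff_quot_cvg_lin. Qed.

Lemma C1_dist f t (e : R) : C1 a b f -> t \in `[a, b] -> 0 < e ->
  exists2 r : R, 0 < r & forall s, s \in `[a, b] -> s != t -> `|t - s| < r ->
    `|dot a b f t - diff_quot f t s| < e.
Proof.
move=> fC tab e0; have /cvgrPdist_lt/(_ e e0) := dot_cvg fC tab.
rewrite /dnbhs near_withinE near_withinE => /nbhs_ballP[r /= r0 rP].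
by exists r => // s sab st ts; exact: rP.
Qed.

Lemma diff_quotE (f : R -> R) t s : f s - f t = diff_quot f t s * (s - t).
Proof.
have [->|st] := eqVneq s t; first by rewrite !subrr mulr0.
by rewrite /diff_quot divfK// subr_eq0.
Qed.

Lemma C1_continuous f : C1 a b f -> {within `[a, b], continuous f}.
Proof.
move=> fC; apply/subspace_continuousP => t tab.
apply/cvgrPdist_lt => e e0; rewrite near_withinE; apply/nbhs_ballP.
have [r r0 rP] := C1_dist fC tab ltr01.
pose M := `|dot a b f t| + 1.
have M0 : 0 < M by rewrite ltr_wpDl.
exists (Num.min r (e / M)) => [/=|s /= ts sab].
  by rewrite lt_min r0 divr_gt0.
move: ts; rewrite /ball/= lt_min => /andP[tsr tse].
have [->|st] := eqVneq s t; first by rewrite subrr normr0.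
rewrite distrC diff_quotE normrM (distrC s t).
have dM : `|diff_quot f t s| < M.
  have := rP s sab st tsr; rewrite distrC => h.
  rewrite -(subrK (dot a b f t) (diff_quot f t s)).
  by apply: le_lt_trans (ler_normD _ _) _; rewrite /M addrC ltrD2l.
apply: le_lt_trans (_ : M * `|t - s| < e); last by rewrite mulrC -ltr_pdivlMr.
by rewrite ler_wpM2r// ltW.
Qed.

(** At interior points the limit along [a, b] is the two-sided one, which gives
    access to the mean value theorem. Caratheodory's criterion is applied to the
    difference quotient extended by the value of the derivative. *)
Lemma C1_is_derive f t : C1 a b f -> t \in `]a, b[ ->
  is_derive t 1 f (dot a b f t).
Proof.
move=> fC tab.
have oc s : s \in `]a, b[ -> s \in `[a, b] 
  by rewrite !in_itv/= => /andP[/ltW-> /ltW->].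
have tab' := oc _ tab.
apply/is_derive1_caratheodory.
exists (fun s => if s == t then dot a b f t else diff_quot f t s); split.
- move=> s; case: eqP => [->|_]; first by rewrite !subrr mulr0.
  exact: diff_quotE.
- apply/cvgrPdist_lt => e e0; rewrite eqxx.
  have [r r0 rP] := C1_dist fC tab' e0.
  near=> s; case: eqP => [_|/eqP st]; first by rewrite subrr normr0.
  apply: rP => //.
  by apply: oc; near: s; exact: near_in_itvoo.
- by rewrite eqxx.
Unshelve. all: by end_near. Qed.

Lemma C1_dot0_cst f : C1 a b f ->
  (forall t, t \in `]a, b[ -> dot a b f t = 0) ->
  forall t, t \in `[a, b] -> f t = f a.
Proof.
move=> fC f0 t; rewrite in_itv/= => /andP[at_ tb].
have ft : {within `[a, t], continuous f}.
  apply: continuous_subspaceW (C1_continuous fC).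
  by apply: subset_itvl; rewrite bnd_simp.
have [|c _] := MVT_segment (df := fun=> 0) at_ _ ft.
  move=> x; rewrite in_itv/= => /andP[ax xt].
  have xab : x \in `]a, b[ by rewrite in_itv/= ax (lt_le_trans xt).
  by rewrite -(f0 x xab); exact: C1_is_derive.
by rewrite mul0r => /eqP; rewrite subr_eq0 => /eqP.
Qed.

Lemma C1mx_mull m n p (A : 'M[R]_(m, n)) (F : R -> 'M[R]_(n, p)) :
  C1mx a b F -> C1mx a b (fun t => A *m F t).
Proof.
move=> FC i j; rewrite (_ : (fun t => _) = fun t => \sum_k A i k * F t k j).
  by apply: C1_lin => k; exact: FC.
by apply/funext => t; rewrite mxE.
Qed.

Lemma dmx_mull m n p (A : 'M[R]_(m, n)) (F : R -> 'M[R]_(n, p)) t :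
  C1mx a b F -> t \in `[a, b] ->
  dmx a b (fun t => A *m F t) t = A *m dmx a b F t.
Proof.
move=> FC tab; apply/matrixP => i j; rewrite !mxE.
rewrite (_ : (fun t => _) = fun t => \sum_k A i k * F t k j).
  by rewrite dot_lin//; apply: eq_bigr => k _; rewrite mxE.
by apply/funext => s; rewrite mxE.
Qed.

Lemma C1mx_tr m n (F : R -> 'M[R]_(m, n)) :
  C1mx a b F -> C1mx a b (fun t => (F t)^T).
Proof.
move=> FC i j; rewrite (_ : (fun t => _) = fun t => F t j i)//.
by apply/funext => t; rewrite mxE.
Qed.

Lemma dmx_tr m n (F : R -> 'M[R]_(m, n)) t :
  dmx a b (fun t => (F t)^T) t = (dmx a b F t)^T.
Proof.
apply/matrixP => i j; rewrite !mxE; congr (dot _ _ _ _).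
by apply/funext => s; rewrite mxE.
Qed.

Lemma dmx_mulr m n p (A : 'M[R]_(n, p)) (F : R -> 'M[R]_(m, n)) t :
  C1mx a b F -> t \in `[a, b] ->
  dmx a b (fun t => F t *m A) t = dmx a b F t *m A.
Proof.
move=> FC tab; apply: trmx_inj; rewrite -dmx_tr trmx_mul -dmx_tr -dmx_mull//.
  by congr (dmx _ _ _ _); apply/funext => s; rewrite trmx_mul.
exact: C1mx_tr.
Qed.

Lemma C1mxD m n (F G : R -> 'M[R]_(m, n)) :
  C1mx a b F -> C1mx a b G -> C1mx a b (fun t => F t + G t).
Proof.
move=> FC GC i j.
(* A sum over two indices, so as to reuse [C1_lin]. *)
pose h (k : bool) t := if k then F t i j else G t i j.
rewrite (_ : (fun t => _) = fun t => \sum_(k <- [:: true; false]) 1 * h k t).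
  by apply: C1_lin => -[]; [exact: FC|exact: GC].
by apply/funext => t; rewrite mxE !big_cons big_nil !mul1r addr0.
Qed.

End one_sided_derivative.

(** * Invertibility of the information matrix *)

Section information_matrix.
Context {R : realType}.
Variables a b : R.
Hypotheses (a0 : 0 < a) (ab : a < b).

Lemma tr_Nmx n (f : R -> 'cV[R]_n) : (Nmx a b f)^T = Nmx a b f.
Proof.
rewrite /Nmx linearD/= linearZ/= tr_intmx trmx_mul trmxK; congr (_ + _).
by apply: eq_intmx => t _; rewrite trmx_mul trmxK.
Qed.

(** For a row vector c, c N c^T is the sum of the integral of ((c f)')^2 and of
    (c f(a))^2 / a. If it is 0 then c f is constant, equal to its value 0
    at a. *)
Lemma Nmx_unit n (f : R -> 'cV[R]_n) : C1mx a b f -> lin_indep a b f ->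
  Nmx a b f \in unitmx.
Proof.
move=> fC fli; rewrite unitmxE unitfE; apply/negP => /det0P[c c0 cN].
have fc := mxcont_dmx fC.
pose phi (t : R) : R := (c *m f t) ord0 ord0.
have phiC : C1 a b phi := C1mx_mull ab c fC ord0 ord0.
have dphi t : t \in `[a, b] -> dot a b phi t = (c *m dmx a b f t) ord0 ord0.
  by move=> tab; rewrite -(dmx_mull ab)// mxE.
have E (v : 'cV[R]_n) :
    (c *m (v *m v^T) *m c^T) ord0 ord0 = ((c *m v) ord0 ord0) ^+ 2.
  rewrite !mulmxA -mulmxA -trmx_mul mxE big_ord1 expr2; congr (_ * _).
  by rewrite mxE.
have sqc : {within `[a, b], continuous (fun t => (dot a b phi t) ^+ 2)}.
  by move=> t; apply: cvgM; case: phiC => _; exact.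
have : (c *m Nmx a b f *m c^T) ord0 ord0 = 0 by rewrite cN mul0mx mxE.
rewrite /Nmx mulmxDr mulmxDl mxE -scalemxAr -scalemxAl [X in _ + X]mxE E.
rewrite -intmx_mull; last exact/mxcont_mul/mxcont_tr.
rewrite -intmx_mulr; last first.
  by apply: mxcont_mul; [exact: mxcont_cst|exact/mxcont_mul/mxcont_tr].
rewrite [X in X + _]mxE.
have -> : (\int[lebesgue_measure]_(t in `[a, b])
     (c *m (dmx a b f t *m (dmx a b f t)^T) *m c^T) ord0 ord0 =
  \int[lebesgue_measure]_(t in `[a, b]) (dot a b phi t) ^+ 2)%R.
  by apply: eq_Rintegral => t; rewrite inE/= => tab; rewrite E dphi.
move=> /eqP; rewrite paddr_eq0; last 2 first.
- by apply: Rintegral_ge0 => t _; exact: sqr_ge0.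
- by rewrite mulr_ge0 ?sqr_ge0// invr_ge0 ltW.
rewrite mulf_eq0 invr_eq0 (gt_eqF a0)/= sqrf_eq0 => /andP[/eqP i0 /eqP fa0].
have phi0 t : t \in `]a, b[ -> dot a b phi t = 0.
  move=> tab; apply/eqP; rewrite -sqrf_eq0; apply/eqP.
  by apply: (Rintegral_continuous_eq0 ab sqc _ i0 tab) => x _; exact: sqr_ge0.
move/eqP: c0; apply; apply: fli => t tab; apply/matrixP => i j.
rewrite !ord1 [RHS]mxE.
by rewrite -/(phi t) (C1_dot0_cst phiC phi0 tab) /phi.
Qed.

End information_matrix.

(** * Covariance of the response *)

Section brownian.
Context {R : realType} {d : measure_display} {Omega : measurableType d}.
Variable P : probability Omega R.
Variables a b : R.

(** As X t is centered, cov(X t, X t) = t is the second moment of X t. *)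
Lemma brownian_Lfun2 (X : R -> {RV P >-> R}) t : brownian a b X ->
  t \in `[a, b] -> (X t : Omega -> R) \in Lfun P 2%:E.
Proof.
move=> [_ EX covX _] tab; apply: sqr_expectation_Lfun2.
  exact: measurable_funPT.
have := covX t t tab tab; rewrite minxx unlock EX//= => h.
rewrite (_ : (fun w => _) = (X t \- cst 0) * (X t \- cst 0)) ?h ?ltry//.
by apply/funext => w; rewrite !fctE/= subr0 expr2.
Qed.

Lemma brownian_rcov (X : R -> {RV P >-> R}) s t : brownian a b X ->
  s \in `[a, b] -> t \in `[a, b] -> rcov P (X s) (X t) = Num.min s t.
Proof. by move=> [_ _ covX _] sab tab; rewrite /rcov covX. Qed.

Lemma indep_rcov0 (X Y : R -> {RV P >-> R}) s t : brownian a b X ->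
  brownian a b Y -> indep_processes `[a, b]%classic X Y ->
  s \in `[a, b] -> t \in `[a, b] -> rcov P (X s) (Y t) = 0.
Proof.
move=> BX BY XY sab tab.
have X2 := brownian_Lfun2 BX sab; have Y2 := brownian_Lfun2 BY tab.
rewrite /rcov covarianceE; last first.
- exact: Lfun2_mul_Lfun1.
- exact: Lfun2_Lfun1.
- exact: Lfun2_Lfun1.
rewrite [X in (X - _)%E](indep_expectationM X2 Y2) ?subee//.
  by case: BX => _ -> // _ _; rewrite mul0e.
move=> A B mA mB; apply: XY; apply: sub_sigma_algebra.
  by exists s, A.
by exists t, B.
Qed.

Definition pair_process (eps1 eps2 : R -> Omega -> R) (t : R) (w : Omega)
    : 'cV[R]_2 := (col_mx (eps1 t w)%:M (eps2 t w)%:M : 'cV[R]_(1 + 1)).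

Lemma pair_processE (eps1 eps2 : R -> Omega -> R) t i :
  (fun w => pair_process eps1 eps2 t w i ord0) =
  if i == ord0 then eps1 t else eps2 t.
Proof.
apply/funext => w; rewrite /pair_process.
have [j ->|j ->] := @split_ordP 1 1 i.
  by rewrite [LHS](@col_mxEu R 1 1 1) mxE !ord1.
by rewrite [LHS](@col_mxEd R 1 1 1) mxE !ord1.
Qed.

Variables eps1 eps2 : R -> {RV P >-> R}.
Hypotheses (B1 : brownian a b eps1) (B2 : brownian a b eps2).
Hypothesis indep : indep_processes `[a, b]%classic eps1 eps2.

Lemma L2vec_pair t : t \in `[a, b] -> L2vec P (pair_process eps1 eps2 t).
Proof.
by move=> tab i; rewrite pair_processE; case: eqP => _; exact: brownian_Lfun2.
Qed.

Lemma xcov_pair s t : s \in `[a, b] -> t \in `[a, b] ->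
  xcov P (pair_process eps1 eps2 s) (pair_process eps1 eps2 t) =
  Num.min s t *: 1%:M.
Proof.
move=> sab tab; apply/matrixP => i j; rewrite !mxE !pair_processE.
have I2 (k : 'I_2) : k = ord0 \/ k = ord_max.
  by case: k => [[|[|//]] k2]; [left|right]; exact: val_inj.
case: (I2 i) => ->; case: (I2 j) => -> /=.
- by rewrite (brownian_rcov B1)// mulr1.
- by rewrite indep_rcov0// mulr0.
- by rewrite rcovC indep_rcov0// mulr0.
- by rewrite (brownian_rcov B2)// mulr1.
Qed.

Section response.
Variables (p0 q1 q2 : nat) (f0 : R -> 'cV[R]_p0).
Variables (g1 : R -> 'cV[R]_q1) (g2 : R -> 'cV[R]_q2).
Variables (S : 'M[R]_2) (theta : 'cV[R]_(p0 + (q1 + q2))).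
Local Notation Y := (response f0 g1 g2 S eps1 eps2 theta).

Lemma L2vec_response t : t \in `[a, b] -> L2vec P (Y t).
Proof.
move=> tab; apply: L2vecD; first exact: L2vec_cst.
exact/L2vec_mul/L2vec_pair.
Qed.

Lemma xcov_response s t : s \in `[a, b] -> t \in `[a, b] ->
  xcov P (Y s) (Y t) = Num.min s t *: (S *m S^T).
Proof.
move=> sab tab.
have Z2 u : u \in `[a, b] -> L2vec P (fun w => S *m pair_process eps1 eps2 u w).
  by move=> uab; exact/L2vec_mul/L2vec_pair.
rewrite xcovDl; [|exact: L2vec_cst|exact: Z2|exact: L2vec_response].
rewrite xcov_cstl add0r xcovDr; [|exact: Z2|exact: L2vec_cst|exact: Z2].
rewrite xcov_cstr add0r xcov_mull; [|exact: L2vec_pair|exact: Z2].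
rewrite xcov_mulr; [|exact: L2vec_pair|exact: L2vec_pair].
by rewrite xcov_pair// -scalemxAl mul1mx scalemxAr.
Qed.

End response.
End brownian.

(** * The Gauss-Markov argument *)

Section gauss_markov.
Context {R : realType} {d : measure_display} {Omega : measurableType d}.
Variable P : probability Omega R.
Variables a b : R.
Hypotheses (a0 : 0 < a) (ab : a < b).

Section estimating_function.
Variables (n : nat) (K : 'M[R]_n) (Y : R -> Omega -> 'cV[R]_n).
Hypothesis Y2 : forall t, t \in `[a, b] -> L2vec P (Y t).
Hypothesis covY : forall s t, s \in `[a, b] -> t \in `[a, b] ->
  xcov P (Y s) (Y t) = Num.min s t *: K.

Lemma L2vec_estimating m (G : R -> 'M[R]_(m, n)) (B : 'M[R]_(m, n)) I :
  is_stoch_int P a b G Y I -> L2vec P (fun w => I w + B *m Y a w).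
Proof.
move=> GI; apply: L2vecD; first exact: L2vec_stoch_int GI.
by apply/L2vec_mul/Y2; rewrite in_itv/= lexx ltW.
Qed.

Lemma xcov_estimating m1 m2 (G : R -> 'M[R]_(m1, n)) (H : R -> 'M[R]_(m2, n))
    (A : 'M[R]_(m1, n)) (B : 'M[R]_(m2, n)) I J :
  mxcont a b G -> mxcont a b H ->
  is_stoch_int P a b G Y I -> is_stoch_int P a b H Y J ->
  xcov P (fun w => I w + A *m Y a w) (fun w => J w + B *m Y a w) =
  intmx a b (fun t => G t *m K *m (H t)^T) + a *: (A *m K *m B^T).
Proof.
move=> Gc Hc GI HJ.
have aab : a \in `[a, b] by rewrite in_itv/= lexx ltW.
have I2 := L2vec_stoch_int ab Y2 GI; have J2 := L2vec_stoch_int ab Y2 HJ.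
have Ya2 := Y2 aab.
have A2 := L2vec_mul A Ya2; have B2 := L2vec_mul B Ya2.
rewrite xcovDl//; last exact: L2vecD.
rewrite !xcovDr// (xcov_stoch_int ab Y2 covY _ GI HJ); last first.
  apply: mxcont_mul; last exact: mxcont_tr.
  by apply: mxcont_mul => //; exact: mxcont_cst.
rewrite xcov_mulr// -(tr_xcov _ (Y a) I) (xcov_stoch_int_init ab Y2 covY GI).
rewrite trmx0 mul0mx addr0 !xcov_mull// (xcov_stoch_int_init ab Y2 covY HJ).
rewrite mulmx0 add0r xcov_mulr// covY// minxx.
by rewrite -scalemxAl -scalemxAr mulmxA.
Qed.

End estimating_function.

(** Integrating G against the component l of Y is integrating G e_l against Y,
    with e_l a unit row vector. This puts the marginal and the joint estimators
    on the same footing, as integrals against Y. *)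
Lemma is_stoch_int_component m (G : R -> 'cV[R]_m) l
    (Y : R -> Omega -> 'cV[R]_2) I :
  is_stoch_int P a b G (component l Y) I ->
  is_stoch_int P a b (fun t => G t *m delta_mx ord0 l) Y I.
Proof.
move=> GI i; have [mI dI] := GI i; split=> // e /dI[delta delta0 {}dI].
exists delta => // s sp sm; have := dI s sp sm.
rewrite (_ : ito_sum a s G (component l Y) =
  ito_sum a s (fun t => G t *m delta_mx ord0 l) Y)//.
apply/funext => w; apply: eq_bigr => k _.
by rewrite /component !rowE -mulmxBr mulmxA.
Qed.

Variables (p q : nat) (F : R -> 'M[R]_(p, 2)) (f : R -> 'cV[R]_q) (l : 'I_2).
Variables (C : 'M[R]_(q, p)) (Sigma : 'M[R]_2) (Y : R -> Omega -> 'cV[R]_2).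
Variables (I : Omega -> 'cV[R]_p) (J : Omega -> 'cV[R]_q).
Hypotheses (FC : C1mx a b F) (fC : C1mx a b f) (fli : lin_indep a b f).
Hypothesis colF : forall t, col l (F t) = C^T *m f t.
Hypotheses (SU : Sigma \in unitmx) (ST : Sigma^T = Sigma).
Hypothesis MU : Mmx a b F Sigma \in unitmx.
Hypothesis Y2 : forall t, t \in `[a, b] -> L2vec P (Y t).
Hypothesis covY : forall s t, s \in `[a, b] -> t \in `[a, b] ->
  xcov P (Y s) (Y t) = Num.min s t *: Sigma.
Hypothesis FI : is_stoch_int P a b (fun t => dmx a b F t *m invmx Sigma) Y I.
Hypothesis fJ : is_stoch_int P a b (dmx a b f) (component l Y) J.

(* Up to the factors M^-1 and N^-1, the BLUE and the marginal estimator. *)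
Let T w := I w + (a^-1 *: (F a *m invmx Sigma)) *m Y a w.
Let U w := J w + (a^-1 *: (f a *m delta_mx ord0 l)) *m Y a w.

Let T2 : L2vec P T. Proof. exact: L2vec_estimating FI. Qed.
Let fJ' := is_stoch_int_component fJ.
Let U2 : L2vec P U. Proof. exact: L2vec_estimating fJ'. Qed.

Let SinvT : (invmx Sigma)^T = invmx Sigma.
Proof. by rewrite trmx_inv ST. Qed.

Let acancel m n (A : 'M[R]_(m, n)) : a *: (a^-1 *: (a^-1 *: A)) = a^-1 *: A.
Proof. by rewrite scalerKV ?gt_eqF. Qed.

Lemma xcov_BLUE_score : xcov P T T = Mmx a b F Sigma.
Proof.
have Gc : mxcont a b (fun t => dmx a b F t *m invmx Sigma).
  by apply: mxcont_mul; [exact: mxcont_dmx|exact: mxcont_cst].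
rewrite (xcov_estimating Y2 covY _ _ Gc Gc FI FI); congr (_ + _).
  by apply: eq_intmx => t _; rewrite trmx_mul SinvT mulmxKV// mulmxA.
rewrite linearZ/= -!scalemxAl -scalemxAr acancel trmx_mul SinvT mulmxKV//.
by rewrite mulmxA.
Qed.

(** The weights F' Sigma^-1 of T cancel Sigma, which leaves
    int F' e_l^T f'^T dt + F(a) e_l^T f(a)^T / a, and F e_l^T = C^T f. *)
Lemma xcov_BLUE_mar_score : xcov P T U = C^T *m Nmx a b f.
Proof.
have Gc : mxcont a b (fun t => dmx a b F t *m invmx Sigma).
  by apply: mxcont_mul; [exact: mxcont_dmx|exact: mxcont_cst].
have Hc : mxcont a b (fun t => dmx a b f t *m (delta_mx ord0 l : 'rV_2)).
  by apply: mxcont_mul; [exact: mxcont_dmx|exact: mxcont_cst].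
rewrite (xcov_estimating Y2 covY _ _ Gc Hc FI fJ') mulmxDr.
rewrite -intmx_mull; last first.
  by apply: mxcont_mul; [|apply: mxcont_tr]; exact: mxcont_dmx.
congr (_ + _).
  apply: eq_intmx => t tab.
  rewrite trmx_mul trmx_delta mulmxKV// !mulmxA.
  rewrite -(dmx_mulr ab)// -(dmx_mull ab)//.
  by congr (dmx _ _ _ _ *m _); apply/funext => s; rewrite -colE colF.
rewrite linearZ/= -!scalemxAl -!scalemxAr acancel trmx_mul trmx_delta mulmxKV//.
by rewrite !mulmxA -colE colF.
Qed.

Lemma BLUE_le_mar :
  loewner_le (Cov P (fun w => C *m theta_BLUE a b F Sigma Y I w))
             (Cov P (theta_mar a b f (component l Y) J)).
Proof.
have NU := Nmx_unit a0 ab fC fli.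
have MT : (Mmx a b F Sigma)^T = Mmx a b F Sigma.
  by rewrite -xcov_BLUE_score tr_xcov.
have BE : (fun w => C *m theta_BLUE a b F Sigma Y I w) =
    fun w => (C *m invmx (Mmx a b F Sigma)) *m T w.
  by apply/funext => w; rewrite /theta_BLUE /T scalemxAl mulmxA.
have ME : theta_mar a b f (component l Y) J =
    fun w => invmx (Nmx a b f) *m U w.
  apply/funext => w; rewrite /theta_mar /U /component rowE.
  congr (_ *m (_ + _)).
  by rewrite mulmxA scalemxAl.
rewrite BE ME; apply: loewner_orthogonal; [exact: L2vec_mul..|].
rewrite !xcov_mull ?xcov_mulr//; try exact: L2vec_mul.
rewrite xcov_BLUE_score xcov_BLUE_mar_score trmx_mul !trmx_inv MT tr_Nmx.
by rewrite !mulmxA mulmxK// mulmxKV.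
Qed.

End gauss_markov.

(** * The model with two groups *)

Section application.
Context {R : realType}.

Lemma Sigma_mx_unit (sigma1 sigma2 rho : R) : 0 < sigma1 -> 0 < sigma2 ->
  -1 < rho -> rho < 1 -> Sigma_mx sigma1 sigma2 rho \in unitmx.
Proof.
move=> s1 s2 rho1 rho2.
pose u := (sigma1 ^+ 2 * sigma2 ^+ 2 * (1 - rho ^+ 2))^-1.
have s1N : sigma1 != 0 by rewrite gt_eqF.
have s2N : sigma2 != 0 by rewrite gt_eqF.
have rhoN : 1 - rho ^+ 2 != 0.
  rewrite gt_eqF// (_ : 1 - rho ^+ 2 = (1 - rho) * (1 + rho)); last by ring.
  by rewrite mulr_gt0//; lra.
(* The inverse: u is the inverse of the determinant. *)
pose B : 'M[R]_(1 + 1) :=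
  block_mx (u * sigma2 ^+ 2)%:M (- (u * (sigma1 * sigma2 * rho)))%:M
           (- (u * (sigma1 * sigma2 * rho)))%:M (u * sigma1 ^+ 2)%:M.
suff : (Sigma_mx sigma1 sigma2 rho : 'M[R]_(1 + 1)) *m B = 1%:M.
  by case/mulmx1_unit.
rewrite /Sigma_mx -/(block_mx _ _ _ _) mulmx_block -!scalar_mxM -!raddfD/=.
rewrite [RHS](scalar_mx_block 1 1 1).
have uE : u * (sigma1 ^+ 2 * sigma2 ^+ 2 * (1 - rho ^+ 2)) = 1.
  by rewrite /u mulVf// !mulf_neq0// sqrf_eq0.
congr block_mx; apply/matrixP => i j; rewrite !ord1 !mxE ?eqxx ?mulr1n.
- by rewrite -uE; ring.
- by ring.
- by ring.
- by rewrite -uE; ring.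
Qed.

Section selection.
Variables (p0 q1 q2 : nat).

(** These matrices extract theta^(1) and theta^(2) from theta. *)
Definition sel1 : 'M[R]_(p0 + q1, p0 + (q1 + q2)) :=
  block_mx 1%:M 0 0 (row_mx 1%:M 0).
Definition sel2 : 'M[R]_(p0 + q2, p0 + (q1 + q2)) :=
  block_mx 1%:M 0 0 (row_mx 0 1%:M).

Lemma subest1E (Omega : Type) (T : Omega -> 'cV[R]_(p0 + (q1 + q2))) :
  subest1 T = fun w => sel1 *m T w.
Proof.
apply/funext => w; rewrite /subest1 /sel1 -[in RHS](vsubmxK (T w)).
rewrite mul_block_col !mul1mx !mul0mx addr0 add0r.
by rewrite -[in RHS](vsubmxK (dsubmx (T w))) mul_row_col mul1mx mul0mx addr0.
Qed.

Lemma subest2E (Omega : Type) (T : Omega -> 'cV[R]_(p0 + (q1 + q2))) :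
  subest2 T = fun w => sel2 *m T w.
Proof.
apply/funext => w; rewrite /subest2 /sel2 -[in RHS](vsubmxK (T w)).
rewrite mul_block_col !mul1mx !mul0mx addr0 add0r.
by rewrite -[in RHS](vsubmxK (dsubmx (T w))) mul_row_col mul1mx mul0mx add0r.
Qed.

Variables (f0 : R -> 'cV[R]_p0) (g1 : R -> 'cV[R]_q1) (g2 : R -> 'cV[R]_q2).

Lemma col_Fmx1 t : col ord0 (Fmx f0 g1 g2 t) = sel1^T *m stack f0 g1 t.
Proof.
rewrite /Fmx /FT -tr_row.
rewrite (_ : (ord0 : 'I_2) = lshift 1 (ord0 : 'I_1)); last exact: val_inj.
rewrite (@rowKu R 1 1) row_id !tr_row_mx !trmxK trmx0 /sel1 /stack tr_block_mx.
rewrite !trmx1 !trmx0 mul_block_col mul1mx !mul0mx addr0 add0r.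
by rewrite tr_row_mx trmx1 trmx0 mul_col_mx mul1mx mul0mx.
Qed.

Lemma col_Fmx2 t : col ord_max (Fmx f0 g1 g2 t) = sel2^T *m stack f0 g2 t.
Proof.
rewrite /Fmx /FT -tr_row.
rewrite (_ : (ord_max : 'I_2) = rshift 1 (ord0 : 'I_1)); last exact: val_inj.
rewrite (@rowKd R 1 1) row_id !tr_row_mx !trmxK trmx0 /sel2 /stack tr_block_mx.
rewrite !trmx1 !trmx0 mul_block_col mul1mx !mul0mx addr0 add0r.
by rewrite tr_row_mx trmx1 trmx0 mul_col_mx mul1mx mul0mx.
Qed.

Variables a b : R.
Hypothesis ab : a < b.

Lemma C1mx_stack n (g : R -> 'cV[R]_n) :
  C1mx a b f0 -> C1mx a b g -> C1mx a b (stack f0 g).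
Proof.
move=> f0C gC.
have -> : stack f0 g = fun t => col_mx 1%:M 0 *m f0 t + col_mx 0 1%:M *m g t.
  apply/funext => t; rewrite !mul_col_mx !mul1mx !mul0mx add_col_mx addr0 add0r.
  by [].
by apply: C1mxD; try exact: ab; apply: C1mx_mull.
Qed.

Lemma C1mx_Fmx : C1mx a b f0 -> C1mx a b g1 -> C1mx a b g2 ->
  C1mx a b (Fmx f0 g1 g2).
Proof.
move=> f0C g1C g2C i l.
have C1col (k : 'I_2) n (C : 'M[R]_(n, p0 + (q1 + q2))) f :
    C1mx a b f -> (forall t, col k (Fmx f0 g1 g2 t) = C^T *m f t) ->
    C1 a b (fun t => Fmx f0 g1 g2 t i k).
  move=> fC kE; rewrite (_ : (fun t => _) = fun t => (C^T *m f t) i ord0).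
    exact: C1mx_mull.
  by apply/funext => t; rewrite -kE [RHS]mxE.
have [->|->] : l = ord0 \/ l = ord_max.
  by case: l => [[|[|//]] k2]; [left|right]; exact: val_inj.
- exact: C1col (C1mx_stack f0C g1C) col_Fmx1.
- exact: C1col (C1mx_stack f0C g2C) col_Fmx2.
Qed.

End selection.
End application.

Unset Implicit Arguments.
Theorem theorem3p3 (R : realType) (a b : R) (ha : 0 < a) (hab : a < b)
  (p0 p1 p2 : nat) (hp1 : (p0 <= p1)%N) (hp2 : (p0 <= p2)%N)
  (f0 : R -> 'cV[R]_p0)
  (g1 : R -> 'cV[R]_(p1 - p0)) (g2 : R -> 'cV[R]_(p2 - p0))
  (hf0 : C1mx a b f0) (hg1 : C1mx a b g1) (hg2 : C1mx a b g2)
  (hli1 : lin_indep a b (stack f0 g1)) (hli2 : lin_indep a b (stack f0 g2))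
  (sigma1 sigma2 : R) (hs1 : 0 < sigma1) (hs2 : 0 < sigma2)
  (d : measure_display) (Omega : measurableType d) (P : probability Omega R)
  (eps1 eps2 : R -> {RV P >-> R})
  (heps1 : brownian a b eps1) (heps2 : brownian a b eps2)
  (hind : indep_processes `[a, b] eps1 eps2)
  (theta0 : 'cV[R]_p0)
  (theta1 : 'cV[R]_(p1 - p0)) (theta2 : 'cV[R]_(p2 - p0)) :
  forall rho : R, -1 < rho -> rho < 1 ->
  let Sigma := Sigma_mx sigma1 sigma2 rho in
  let G := Fmx f0 g1 g2 in
  Mmx a b G Sigma \in unitmx ->
  forall S : 'M[R]_2, is_sqrtmx Sigma S ->
  let Y : R -> Omega -> 'cV[R]_2 :=
    response f0 g1 g2 S eps1 eps2 (col_mx theta0 (col_mx theta1 theta2)) in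
  forall (I : Omega -> 'cV[R]_(p0 + ((p1 - p0) + (p2 - p0))))
         (I1 : Omega -> 'cV[R]_(p0 + (p1 - p0)))
         (I2 : Omega -> 'cV[R]_(p0 + (p2 - p0))),
  is_stoch_int P a b (fun t => dmx a b G t *m invmx Sigma) Y I ->
  is_stoch_int P a b (dmx a b (stack f0 g1)) (component ord0 Y) I1 ->
  is_stoch_int P a b (dmx a b (stack f0 g2)) (component ord_max Y) I2 ->
  loewner_le (Cov P (subest1 (theta_BLUE a b G Sigma Y I)))
             (Cov P (theta_mar a b (stack f0 g1) (component ord0 Y) I1)) /\
  loewner_le (Cov P (subest2 (theta_BLUE a b G Sigma Y I)))
             (Cov P (theta_mar a b (stack f0 g2) (component ord_max Y) I2)).
Proof.
move=> rho rho1 rho2 Sigma G MU S [[ST _] SS] Y I I1 I2 HI HI1 HI2.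
have SU : Sigma \in unitmx by exact: Sigma_mx_unit.
have SigT : Sigma^T = Sigma by rewrite -SS trmx_mul ST.
have Y2 t : t \in `[a, b] -> L2vec P (Y t) by exact: L2vec_response.
have covY s t : s \in `[a, b] -> t \in `[a, b] ->
    xcov P (Y s) (Y t) = Num.min s t *: Sigma.
  by move=> sab tab; rewrite (xcov_response heps1 heps2 hind) // ST SS.
have GC : C1mx a b G by exact: C1mx_Fmx.
have f1C := C1mx_stack hab hf0 hg1; have f2C := C1mx_stack hab hf0 hg2.
rewrite subest1E subest2E; split.
- exact: (BLUE_le_mar ha hab GC f1C hli1 (col_Fmx1 f0 g1 g2) SU SigT MU
            Y2 covY HI HI1).
- exact: (BLUE_le_mar ha hab GC f2C hli2 (col_Fmx2 f0 g1 g2) SU SigT MU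
            Y2 covY HI HI2).
Qed.
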